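(* Let $k\ge 1$ and $n>1$ be integers, let $h\in[k]$, and let $\ell_1,\dots,\ell_k$ be nonnegative integers with $\ell_1+\ell_2+\cdots+\ell_k=n$. The number of $k$-noncrossing trees with root label $h$, $\ell_i$ vertices labelled $i$ (for each $i\in[k]$) and $n$ vertices in total is \begin{align*} &\frac{2\ell_h}{(2n-1)(4n-3)} \prod_{r=1}^{\lceil k/2 \rceil} \binom{3n-2-\sum_{j=1}^{r-1} \ell_j - \sum_{j=k+2-r}^k \ell_j}{\ell_r} \\ &\qquad \prod_{r=1}^{h-1} \binom{n - 2 + \sum_{j=1}^{r} \ell_j + \sum_{j=k+1-r}^k \ell_j}{\ell_{k+1-r}} \prod_{r=h}^{\lfloor k/2 \rfloor} \binom{n - 1 + \sum_{j=1}^{r} \ell_j + \sum_{j=k+1-r}^k \ell_j}{\ell_{k+1-r}} \\ &\quad - \frac{\ell_h }{(4n-3)(3n-2-\sum_{j=1}^{h-1} \ell_j - \sum_{j=k+2-h}^k \ell_j)} \prod_{r=1}^{\lfloor k/2 \rfloor} \binom{n - 1 + \sum_{j=1}^{r} \ell_j + \sum_{j=k+1-r}^k \ell_j}{\ell_{k+1-r}} \\ &\qquad \prod_{r=1}^{h-1} \binom{3n-3-\sum_{j=1}^{r-1} \ell_j - \sum_{j=k+2-r}^k \ell_j}{\ell_r} \prod_{r=h}^{\lceil k/2 \rceil} \binom{3n-2-\sum_{j=1}^{r-1} \ell_j - \sum_{j=k+2-r}^k \ell_j}{\ell_r} \end{align*} if $h \leq \lceil k/2 \rceil$, and \begin{align*}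 &\frac{\ell_h}{(n-1)(4n-3)} \prod_{r=1}^{\lfloor k/2 \rfloor} \binom{n - 2 + \sum_{j=1}^{r} \ell_j + \sum_{j=k+1-r}^k \ell_j}{\ell_{k+1-r}} \\ &\qquad \prod_{r=1}^{k+1-h} \binom{3n-2-\sum_{j=1}^{r-1} \ell_j - \sum_{j=k+2-r}^k \ell_j}{\ell_r} \prod_{r=k+2-h}^{\lceil k/2 \rceil} \binom{3n-3-\sum_{j=1}^{r-1} \ell_j - \sum_{j=k+2-r}^k \ell_j}{\ell_r} \\ &\quad - \frac{\ell_h }{(4n-3)(n - 1 + \sum_{j=1}^{k+1-h} \ell_j + \sum_{j=h}^k \ell_j)} \prod_{r=1}^{\lceil k/2 \rceil} \binom{3n-3-\sum_{j=1}^{r-1} \ell_j - \sum_{j=k+2-r}^k \ell_j}{\ell_r} \\ &\qquad \prod_{r=1}^{k+1-h} \binom{n - 1 + \sum_{j=1}^{r} \ell_j + \sum_{j=k+1-r}^k \ell_j}{\ell_{k+1-r}} \prod_{r=k+2-h}^{\lfloor k/2 \rfloor} \binom{n - 2 + \sum_{j=1}^{r} \ell_j + \sum_{j=k+1-r}^k \ell_j}{\ell_{k+1-r}} \end{align*} otherwise. The total number (over all root labels) of $k$-noncrossing trees with $\ell_i$ vertices labelled $i$ (for each $i\in[k]$) and $n$ vertices in total is \begin{multline*} \frac{1}{n-1} \prod_{r=1}^{\lceil k/2 \rceil} \binom{3n-3-\sum_{j=1}^{r-1} \ell_j - \sum_{j=k+2-r}^k \ell_j}{\ell_r} \prod_{r=1}^{\lfloor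 k/2 \rfloor} \binom{n - 2 + \sum_{j=1}^{r} \ell_j + \sum_{j=k+1-r}^k \ell_j}{\ell_{k+1-r}} \\ - \frac{1}{2n-1} \prod_{r=1}^{\lceil k/2 \rceil} \binom{3n-2-\sum_{j=1}^{r-1} \ell_j - \sum_{j=k+2-r}^k \ell_j}{\ell_r} \prod_{r=1}^{\lfloor k/2 \rfloor} \binom{n - 1 + \sum_{j=1}^{r} \ell_j + \sum_{j=k+1-r}^k \ell_j}{\ell_{k+1-r}}. \end{multline*}
   Context: $[k]=\{1,2,\dots,k\}$. A noncrossing tree with $n$ vertices is a tree on the vertices $v_1,v_2,\dots,v_n$, placed as points on a circle in this order, such that the edges, drawn as line segments between these points, do not intersect at interior points; its root is $v_1$. A $k$-noncrossing tree is a noncrossing tree whose vertices carry labels in $[k]$ such that whenever $v_i,v_j$ are adjacent with $i<j$ and the path from the root $v_1$ to $v_j$ contains $v_i$ (this includes the case $i=1$), the sum of the labels of $v_i$ and $v_j$ is at most $k+1$. (There is no restriction on edges $v_iv_j$, $i<j$, for which the path from $v_1$ to $v_j$ does not contain $v_i$.) Empty products are $1$ and empty sums are $0$. Binomial coefficients are $\binom{a}{b}=a(a-1)\cdots(a-b+1)/b!$ for integers $a$ and $b\ge 0$. *)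

(* Defs.v *)
From HB Require Import structures.
From mathcomp Require Export all_boot all_order all_algebra.

Set Implicit Arguments.
Unset Strict Implicit.
Unset Printing Implicit Defensive.

Import GRing.Theory.

Section NoncrossingTrees.
Variable n : nat.

(* The vertex v_i is the element of 'I_n of value i - 1, so that the order on
   'I_n is the order of the vertices along the circle.  An edge is a
   two-element set of vertices. *)
Implicit Types (E : {set {set 'I_n}}).

Definition is_graph E : bool := [forall e in E, #|e| == 2].

Definition adj E : rel 'I_n := fun i j => [set i; j] \in E.

Definition connected_graph E : bool :=
  [forall i : 'I_n, forall j : 'I_n, connect (adj E) i j].

(* A simple cycle visits pairwise distinct vertices, so it has at most n of
   them; cycles of a simple graph have at least 3 vertices. *)
Definition acyclic_graph E : bool :=
  [forall m : 'I_n.+1, forall c : m.-tuple 'I_n,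
     (2 < m) ==> ~~ ucycleb (adj E) c].

Definition is_tree E : bool :=
  [&& is_graph E, connected_graph E & acyclic_graph E].

(* Two chords of a circle meet at a point interior to both exactly when their
   endpoints are four distinct points that alternate along the circle. *)
Definition noncrossing E : bool :=
  [forall a : 'I_n, forall b : 'I_n, forall c : 'I_n, forall d : 'I_n,
     ~~ [&& adj E a b, adj E c d, a < c, c < b & b < d]].

Definition is_root (r : 'I_n) : bool := (r : nat) == 0.

(* The (unique, when E is a tree) simple path from the root to j contains i.
   Such a path r :: p has at most n vertices, so p has fewer than n. *)
Definition on_root_path E (i j : 'I_n) : bool :=
  [exists r : 'I_n, is_root r &&
    [exists m : 'I_n, exists p : m.-tuple 'I_n,
       [&& path (adj E) r p, uniq (r :: p), last r p == j & i \in r :: p]]].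

Variable k : nat.

(* A labelling has values in 'I_k.+1 = {0, ..., k}; the value 0 is ruled out
   by is_labelling, so that labels are the elements of [k] themselves. *)
Implicit Types (f : {ffun 'I_n -> 'I_k.+1}).

Definition is_labelling f : bool := [forall v : 'I_n, 0 < f v].

Definition label_bound E f : bool :=
  [forall i : 'I_n, forall j : 'I_n,
     [&& adj E i j, i < j & on_root_path E i j] ==> (f i + f j <= k.+1)].

Definition k_noncrossing_tree E f : bool :=
  [&& is_tree E, noncrossing E, is_labelling f & label_bound E f].

Definition has_content (l : nat -> nat) f : bool :=
  [forall c : 'I_k.+1, (0 < c) ==> (#|[set v : 'I_n | f v == c]| == l c)].

Definition root_label (h : nat) f : bool :=
  [forall r : 'I_n, is_root r ==> ((f r : nat) == h)].

Definition k_noncrossing_trees (l : nat -> nat) :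
    {set {set {set 'I_n}} * {ffun 'I_n -> 'I_k.+1}} :=
  [set t | k_noncrossing_tree t.1 t.2 && has_content l t.2].

Definition k_noncrossing_trees_root (l : nat -> nat) (h : nat) :
    {set {set {set 'I_n}} * {ffun 'I_n -> 'I_k.+1}} :=
  [set t in k_noncrossing_trees l | root_label h t.2].

End NoncrossingTrees.

Local Open Scope ring_scope.

Definition binq (a : int) (b : nat) : rat :=
  (\prod_(i < b) (a - i%:Z)%:~R) / (b`!)%:R.

(* l_1 + ... + l_(r-1)  +  l_(k+2-r) + ... + l_k *)
Definition sumA (k : nat) (l : nat -> nat) (r : nat) : nat :=
  (\sum_(1 <= j < r) l j + \sum_(k.+2 - r <= j < k.+1) l j)%N.

(* l_1 + ... + l_r  +  l_(k+1-r) + ... + l_k *)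
Definition sumB (k : nat) (l : nat -> nat) (r : nat) : nat :=
  (\sum_(1 <= j < r.+1) l j + \sum_(k.+1 - r <= j < k.+1) l j)%N.

(* binomial (3n - c - sumA r) over l_r *)
Definition binA (n k : nat) (l : nat -> nat) (c r : nat) : rat :=
  binq (3 * n%:Z - c%:Z - (sumA k l r)%:Z) (l r).

(* binomial (n - c + sumB r) over l_(k+1-r) *)
Definition binB (n k : nat) (l : nat -> nat) (c r : nat) : rat :=
  binq (n%:Z - c%:Z + (sumB k l r)%:Z) (l (k.+1 - r)%N).

(* Main.v *)
(* A nonroot vertex v of a noncrossing tree, together with its descendants, is a
   pair of noncrossing trees glued at v, one on each side.  Let B_i be the
   generating function of these pairs and N_i that of the trees with root label
   i, in the variables x_1, ..., x_k that mark the labels, and put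
   U_j = 1 - B_1 - ... - B_j.  Then B_i U_k = N_i and N_i U_(k+1-i) = x_i, so
   (U_(i-1) - U_i) U_k U_(k+1-i) = x_i.  With u = U_k, x_i = y_i u^2 and
   sigma_i = y_1 - y_k + y_2 - y_(k-1) + ... (i terms), each U_j is a monomial in
   the factors 1 - sigma_i, hence Lagrange inversion gives the coefficients of
   all monomials in the U_j, and the coefficient of a power product of the
   factors 1 - sigma_i is a product of binomial coefficients.  That the closed
   form obtained in this way is correct is proved without Lagrange inversion: it
   satisfies the linear recurrences that the relations between the U_j impose on
   the coefficients of their monomials, and these recurrences have a unique
   solution.  The theorem is the case of the monomials 1 / U_(k+1-h), U_k and
   U_k^2, as N_h = x_h / U_(k+1-h) and sum_h N_h = U_k - U_k^2. *)

Require Import Defs.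
From mathcomp Require Import all_boot all_order all_algebra.
From mathcomp Require Import mpoly.
From mathcomp Require Import ring zify.

Set Implicit Arguments.
Unset Strict Implicit.
Unset Printing Implicit Defensive.

(** * Rooted noncrossing trees as parent functions *)

(** Write s_0, s_1, s_2, ... for U_0, U_k, U_1, U_(k-1), .... In this zigzag order the relation of
    each label involves, apart from u, three consecutive terms, and the relations amount to s_i
    s_(i+1) = u (1 - sigma_i). So every s_i is a product of factors 1 - sigma_j with exponents 1 or
    -1, times u when i is odd. The zigzag meets itself at the middle label, s_k = s_(k+1); hence
    s_k^2 = u (1 - sigma_k), which expresses u through the factors as well. Lagrange's formula
    serves only as the definition of a candidate. The relation of label j passes from U_(j-1) to U_j
    at the cost of a term whose content has one vertex fewer, and U_0 = 1; induction on the content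
    and then on the monomial leaves no freedom. The vertex set ['I_n] fixes the size, so the
    generating functions are polynomials that agree with the power series up to degree n only, and 1
    / U_j becomes a finite geometric sum. Trees are parent functions on intervals, because removing
    an extreme branch at the root splits an interval into two. *)

Section Iterates.
Variables (T : finType) (p : T -> T).

(** Induction on the distance to the root: properties are carried down from [r] through a tree given
    by its parent function. *)
Lemma fconnect_ind (r : T) (P : T -> Prop) :
    P r -> (forall x, x != r -> fconnect p x r -> P (p x) -> P x) ->
  forall x, fconnect p x r -> P x.
Proof.
move=> Pr Ps x /iter_findex; move: (findex _ _ _) => m.
elim: m x => [|m IH] x; first by move=> /= ->.
rewrite iterSr => E; have [->//|xr] := eqVneq x r.
apply: Ps => //; last exact: IH.
by rewrite -E -iterSr fconnect_iter.
Qed.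

(** Discrete intermediate value principle, used to find the edge by which a path leaves a region of
    the circle. *)
Lemma fconnect_exit (A : pred T) x r : fconnect p x r -> A x -> ~~ A r ->
  exists2 u, A u & ~~ A (p u).
Proof.
move=> xr Ax Ar; have [/existsP[u /andP[]]|] := boolP [exists u, A u && ~~ A (p u)].
  by exists u.
rewrite negb_exists => /forallP H.
suff : ~~ A x by rewrite Ax.
elim/fconnect_ind: x / xr Ax => // x _ _ IH Ax.
by have := H x; rewrite Ax negbK /= => Apx; have := IH Apx; rewrite Apx.
Qed.

Lemma fconnect_step x r : x != r -> fconnect p x r -> fconnect p (p x) r.
Proof.
move=> xr /iter_findex; case: (findex _ _ _) => [/= E|m].
  by rewrite E eqxx in xr.
by rewrite iterSr => <-; apply: fconnect_iter.
Qed.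

Lemma fconnect_fix r x : p r = r -> fconnect p r x -> x = r.
Proof.
by move=> pr /iter_findex <-; elim: (findex _ _ _) => //= m ->.
Qed.

End Iterates.

Section Structures.
Variables (n k : nat).
Local Notation vertex := 'I_n.
Local Notation labelled := {ffun vertex -> vertex * 'I_k.+1}.
Implicit Types (g : labelled) (x y r : vertex) (V : {set vertex}).

Definition par g x : vertex := (g x).1.
Definition lbl g x : 'I_k.+1 := (g x).2.

(* The edge joining x to its parent is the chord from lo g x to hi g x; the
   root is its own parent, which gives a chord of length 0. *)
Definition lo g x : nat := minn x (par g x).
Definition hi g x : nat := maxn x (par g x).

(* Labelled noncrossing trees on V with root r, given by the parent function
   and such that no edge passes over r; outside V the values are fixed. *)
Definition rooted_tree V r g : bool :=
  [&& r \in V,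
      [forall x, if x \in V then (par g x \in V) && fconnect (par g) x r
                 else g x == (x, ord0)],
      par g r == r,
      [forall x, forall y, ~~ [&& lo g x < lo g y, lo g y < hi g x
                                & hi g x < hi g y]],
      [forall x, ~~ (lo g x < r < hi g x)]
    & [forall x, (par g x < x) ==> (lbl g (par g x) + lbl g x <= k.+1)]].

Record rooted_tree_spec V r g : Prop := RootedTree {
  rt_root : r \in V;
  rt_closed : forall x, x \in V -> par g x \in V;
  rt_connect : forall x, x \in V -> fconnect (par g) x r;
  rt_outside : forall x, x \notin V -> g x = (x, ord0);
  rt_par_root : par g r = r;
  rt_noncrossing : forall x y,
    ~ (lo g x < lo g y /\ lo g y < hi g x /\ hi g x < hi g y);
  rt_uncovered : forall x, ~ (lo g x < r /\ r < hi g x);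
  rt_label : forall x, par g x < x -> lbl g (par g x) + lbl g x <= k.+1 }.

Lemma rooted_treeP V r g : reflect (rooted_tree_spec V r g) (rooted_tree V r g).
Proof.
apply: (iffP and5P) => [[h1 /forallP h2 /eqP h3 /forallP h4 h56]|H].
  have /andP[/forallP h5 /forallP h6] := h56.
  split=> //.
  - by move=> x xV; have := h2 x; rewrite xV => /andP[].
  - by move=> x xV; have := h2 x; rewrite xV => /andP[].
  - by move=> x /negPf xV; have := h2 x; rewrite xV => /eqP.
  - move=> x y [a [b c]]; have /forallP/(_ y) := h4 x.
    by rewrite a b c.
  - by move=> x [a b]; have := h5 x; rewrite a b.
  - by move=> x px; have := h6 x; rewrite px.
case: H => h1 h2 h3 h4 h5 h6 h7 h8; split=> //.
- apply/forallP => x; case: ifP => xV; first by rewrite h2 // h3.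
  by rewrite h4 // xV.
- exact/eqP.
- apply/forallP => x; apply/forallP => y; apply/negP => /and3P[a b c].
  by apply: (h6 x y).
- apply/andP; split; apply/forallP => x.
    by apply/negP => /andP[a b]; apply: (h7 x).
  by apply/implyP; apply: h8.
Qed.

Lemma rt_par_outside V r g x : rooted_tree_spec V r g -> x \notin V ->
  par g x = x.
Proof. by move=> H xV; rewrite /par (rt_outside H). Qed.

(** * Attaching a tree to the root of another one *)

Definition attach V' r r' g g' : labelled :=
  [ffun x => if x \in V' then (if x == r' then (r, (g' x).2) else g' x)
             else g x].

Definition separated V V' : Prop :=
  (forall x y, x \in V -> y \in V' -> x < y)
  \/ (forall x y, x \in V -> y \in V' -> y < x).

Section Attach.
Variables (V V' : {set vertex}) (r r' : vertex) (g g' : labelled).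
Hypotheses (Hg : rooted_tree_spec V r g) (Hg' : rooted_tree_spec V' r' g').
Hypothesis sep : separated V V'.

Let G := attach V' r r' g g'.

Let disj x : x \in V -> x \in V' -> False.
Proof. by case: sep => s xV xV'; have := s x x xV xV'; rewrite ltnn. Qed.

Let G_in x : x \in V -> G x = g x.
Proof.
by move=> xV; rewrite ffunE; case: ifP => // xV'; case: (disj xV xV').
Qed.

Let G_in' x : x \in V' -> x != r' -> G x = g' x.
Proof. by move=> xV' /negPf xr; rewrite ffunE xV' xr. Qed.

Let G_r' : G r' = (r, lbl g' r').
Proof. by rewrite ffunE (rt_root Hg') eqxx. Qed.

Let lbl_in' x : x \in V' -> lbl G x = lbl g' x.
Proof.
move=> xV'; have [->|xr] := eqVneq x r'; first by rewrite /lbl G_r'.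
by rewrite /lbl G_in'.
Qed.

Let G_out x : x \notin V -> x \notin V' -> G x = (x, ord0).
Proof. by move=> xV /negPf xV'; rewrite ffunE xV' (rt_outside Hg). Qed.

Lemma attach_par_in' x : x \in V' -> x != r' -> par G x = par g' x.
Proof. by move=> xV xr; rewrite /par G_in'. Qed.

Lemma attach_par_root' : par G r' = r.
Proof. by rewrite /par G_r'. Qed.

Lemma attach_par_in x : x \in V -> par G x = par g x.
Proof. by move=> xV; rewrite /par G_in. Qed.

Lemma attach_lbl_in x : x \in V -> lbl G x = lbl g x.
Proof. by move=> xV; rewrite /lbl G_in. Qed.

Lemma attach_lbl_in' x : x \in V' -> lbl G x = lbl g' x.
Proof. exact: lbl_in'. Qed.

Lemma attach_connect_root' x : x \in V' -> fconnect (par G) x r'.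
Proof.
move=> xV'; have := rt_connect Hg' xV'; move: xV'.
move=> /[swap]; elim/fconnect_ind: x / => [_|x xr _ IH xV']; first exact: connect0.
apply: connect_trans (fconnect1 _ _) _; rewrite attach_par_in' //.
by apply: IH; apply: (rt_closed Hg').
Qed.

Lemma attach_connect_root x : x \in V -> fconnect (par G) x r.
Proof.
move=> xV; have := rt_connect Hg xV; move: xV.
move=> /[swap]; elim/fconnect_ind: x / => [_|x xr _ IH xV]; first exact: connect0.
apply: connect_trans (fconnect1 _ _) _; rewrite attach_par_in //.
by apply: IH; apply: (rt_closed Hg).
Qed.

(** Lets the second tree be recognized inside the glued one, as the branch of [r']; injectivity of
    gluing rests on it. *)
Lemma attach_connectE x : fconnect (par G) x r' = (x \in V').
Proof.
apply/idP/idP; last exact: attach_connect_root'.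
elim/fconnect_ind: x /; first exact: rt_root Hg'.
move=> x xr _; have [//|xV'] := boolP (x \in V').
have [xV|xV] := boolP (x \in V).
  rewrite attach_par_in // => pV'.
  by case: (disj (rt_closed Hg xV) pV').
by rewrite /par G_out //= (negPf xV').
Qed.

Let arc x : [\/ (x \in V /\ par G x = par g x),
   (x \in V' /\ par G x = par g' x), x = r' /\ par G x = r | par G x = x].
Proof.
have [xV|xV] := boolP (x \in V); first by constructor 1; rewrite attach_par_in.
have [xV'|xV'] := boolP (x \in V'); last by constructor 4; rewrite /par G_out.
have [->|xr] := eqVneq x r'; first by constructor 3; rewrite attach_par_root'.
by constructor 2; rewrite attach_par_in'.
Qed.

Let sep4 x y x' y' : x \in V -> y \in V -> x' \in V' -> y' \in V' ->
  [&& x < x', x < y', y < x' & y < y'] || [&& x' < x, x' < y, y' < x & y' < y].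
Proof.
case: sep => s xV yV xV' yV'; apply/orP; [left|right].
  by apply/and4P; split; apply: s.
by apply/and4P; split; apply: s.
Qed.

Lemma attach_rooted_tree : (r < r' -> lbl g r + lbl g' r' <= k.+1) ->
  rooted_tree_spec (V :|: V') r G.
Proof.
move=> Hlbl; have rV := rt_root Hg; have rV' := rt_root Hg'.
split.
- by rewrite inE rV.
- move=> x; rewrite !inE => /orP[xV|xV'].
    by rewrite attach_par_in // (rt_closed Hg).
  have [->|xr] := eqVneq x r'; first by rewrite attach_par_root' rV.
  by rewrite attach_par_in' // (rt_closed Hg') ?orbT.
- move=> x; rewrite !inE => /orP[xV|xV']; first exact: attach_connect_root.
  apply: connect_trans (attach_connect_root' xV') _.
  by rewrite -attach_par_root' fconnect1.
- by move=> x; rewrite inE negb_or => /andP[]; apply: G_out.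
- by rewrite attach_par_in // (rt_par_root Hg).
(* The only new chord joins [r] to [r']. Since [V] and [V'] are separated, a chord crossing it would
   have to pass over [r] or [r']. *)
- move=> x y; rewrite /lo /hi.
  case: (arc x) => [[xV ->]|[xV ->]|[-> ->]|->];
  case: (arc y) => [[yV ->]|[yV ->]|[-> ->]|->]; try lia.
  + exact: (rt_noncrossing Hg).
  + by have := sep4 xV (rt_closed Hg xV) yV (rt_closed Hg' yV); lia.
  + have := sep4 xV (rt_closed Hg xV) rV' rV'; have := sep4 rV rV rV' rV'.
    by have := rt_uncovered Hg (x := x); rewrite /lo /hi; lia.
  + by have := sep4 yV (rt_closed Hg yV) xV (rt_closed Hg' xV); lia.
  + exact: (rt_noncrossing Hg').
  + have := sep4 rV rV xV (rt_closed Hg' xV); have := sep4 rV rV rV' rV'.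
    by have := rt_uncovered Hg' (x := x); rewrite /lo /hi; lia.
  + have := sep4 yV (rt_closed Hg yV) rV' rV'; have := sep4 rV rV rV' rV'.
    by have := rt_uncovered Hg (x := y); rewrite /lo /hi; lia.
  + have := sep4 rV rV yV (rt_closed Hg' yV); have := sep4 rV rV rV' rV'.
    by have := rt_uncovered Hg' (x := y); rewrite /lo /hi; lia.
- move=> x; rewrite /lo /hi.
  case: (arc x) => [[xV ->]|[xV ->]|[-> ->]|->]; try lia.
  + exact: (rt_uncovered Hg).
  + by have := sep4 rV rV xV (rt_closed Hg' xV); lia.
- move=> x; have [xV|xV] := boolP (x \in V).
    rewrite attach_par_in // !attach_lbl_in ?(rt_closed Hg) //.
    exact: (rt_label Hg).
  have [xV'|xV'] := boolP (x \in V'); last by rewrite /par G_out //= ltnn.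
  have [->|xr] := eqVneq x r'.
    by rewrite attach_par_root' attach_lbl_in // lbl_in'.
  rewrite attach_par_in' // !lbl_in' ?(rt_closed Hg') //.
  exact: (rt_label Hg').
Qed.

End Attach.

(** Attaching overwrites only the parent of [r'], and in both second trees that parent is [r']
    itself. *)
Lemma attach_inj V V' r r' g g' h h' : separated V V' ->
    rooted_tree_spec V r g -> rooted_tree_spec V' r' g' ->
    rooted_tree_spec V r h -> rooted_tree_spec V' r' h' ->
  attach V' r r' g g' = attach V' r r' h h' -> g = h /\ g' = h'.
Proof.
move=> sep Hg Hg' Hh Hh' /ffunP E.
have disj x : x \in V' -> x \notin V.
  move=> xV'; apply/negP => xV.
  by case: sep => s; have := s x x xV xV'; rewrite ltnn.
split; apply/ffunP => x; have := E x; rewrite !ffunE.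
  case: ifP => xV' //; have xV := disj x xV'.
  by rewrite (rt_outside Hg) // (rt_outside Hh).
case: ifP => xV'; last by rewrite (rt_outside Hg') ?xV' // (rt_outside Hh') ?xV'.
case: eqP => // -> [E2].
have := rt_par_root Hg'; have := rt_par_root Hh'; rewrite /par.
by move: (g' r') (h' r') E2 => [? ?] [? ?] /= -> -> ->.
Qed.

End Structures.

(** * Cutting off the branch of a child of the root *)

Definition crosses (a b c d : nat) :=
  minn a b < minn c d /\ minn c d < maxn a b /\ maxn a b < maxn c d.

(** An edge leaving the segment between [x] and [j] cannot end beyond [j] without crossing the chord
    from [r] to [j]. So it ends on the side of [x], passing over [x] but not over [j]. *)
Lemma chord_separates (r x j u p : nat) :
    (r < x /\ x < j) \/ (j < x /\ x < r) ->
    (x < u < j) || (j < u < x) -> p != x -> p != j ->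
    ~~ ((x < p < j) || (j < p < x)) ->
    ~ crosses j r u p -> ~ crosses u p j r ->
  (minn u p < x < maxn u p) && ~~ (minn u p < j < maxn u p).
Proof.
move=> h1 h2 h3 h4 h5; rewrite /crosses.
case: h1 => -[a b].
  rewrite (minn_idPr (ltnW (ltn_trans a b))) (maxn_idPl (ltnW (ltn_trans a b))).
  by case: (leqP u p) => h; lia.
rewrite (minn_idPl (ltnW (ltn_trans a b))) (maxn_idPr (ltnW (ltn_trans a b))).
by case: (leqP u p) => h; lia.
Qed.

Lemma chord_exit (z q u p : nat) :
    minn u p < z < maxn u p -> ~~ (minn u p < q < maxn u p) ->
    q != u -> q != p -> crosses z q u p \/ crosses u p z q.
Proof.
rewrite /crosses.
by case: (leqP u p) => h; case: (leqP z q) => h'; lia.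
Qed.

Section Cut.
Variables (n k : nat).
Local Notation vertex := 'I_n.
Local Notation labelled := {ffun vertex -> vertex * 'I_k.+1}.
Variables (V : {set vertex}) (r j : vertex) (g : labelled).
Hypotheses (Hg : rooted_tree_spec V r g) (jr : j != r) (pj : par g j = r).

Definition branch : {set vertex} := [set x | fconnect (par g) x j].

Definition cut_branch : labelled :=
  [ffun x => if x \in branch then (if x == j then (j, lbl g j) else g x)
             else (x, ord0)].

Definition cut_rest : labelled :=
  [ffun x => if x \in branch then (x, ord0) else g x].

Lemma branch_closed x : x \in branch -> x != j -> par g x \in branch.
Proof. by rewrite !inE => xj /fconnect_step; apply. Qed.

Lemma branch_par x : par g x \in branch -> x \in branch.
Proof. by rewrite !inE; apply: connect_trans; apply: fconnect1. Qed.

Lemma root_branch : r \notin branch.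
Proof.
rewrite inE; apply/negP => /(fconnect_fix (rt_par_root Hg)) E.
by have := jr; rewrite E eqxx.
Qed.

Lemma child_in : j \in V.
Proof.
apply/negPn/negP => jV; have := rt_par_outside Hg jV.
by rewrite pj => E; have := jr; rewrite E eqxx.
Qed.

Lemma mem_branch : j \in branch.
Proof. by rewrite inE connect0. Qed.

Lemma branch_sub : branch \subset V.
Proof.
apply/subsetP => x; rewrite inE; elim/fconnect_ind: x /; first exact: child_in.
move=> x xj _ IH; apply/negPn/negP => xV.
by move: IH; rewrite (rt_par_outside Hg xV) (negPf xV).
Qed.

Hypothesis sep : separated (V :\: branch) branch.

Lemma cut_branch_tree : rooted_tree_spec branch j cut_branch.
Proof.
have rV : r \in V :\: branch by rewrite in_setD root_branch (rt_root Hg).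
have par_in x : x \in branch -> x != j -> par cut_branch x = par g x.
  by move=> xB /negPf xj; rewrite /par ffunE xB xj.
have par_j : par cut_branch j = j.
  by rewrite /par ffunE mem_branch eqxx.
have lbl_in x : x \in branch -> lbl cut_branch x = lbl g x.
  by move=> xB; rewrite /lbl ffunE xB; case: eqP => [->|].
have par_out x : x \notin branch -> par cut_branch x = x.
  by move=> /negPf xB; rewrite /par ffunE xB.
have arc x : [\/ x \in branch /\ x != j /\ par cut_branch x = par g x
               | par cut_branch x = x].
  have [xB|xB] := boolP (x \in branch); last by right; apply: par_out.
  by have [->|xj] := eqVneq x j; [right|left; rewrite par_in].
have sepr x : x \in branch -> (r < x /\ r < j) \/ (x < r /\ j < r).
  move=> xB; have jB := mem_branch.
  by case: sep => s; [left|right]; split; apply: s.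
split.
- exact: mem_branch.
- move=> x xB; have [->|xj] := eqVneq x j; first by rewrite par_j mem_branch.
  by rewrite par_in // branch_closed.
- move=> x; rewrite inE => xj.
  elim/fconnect_ind: x / xj; first exact: connect0.
  move=> x xj xB IH; apply: connect_trans (fconnect1 _ _) _.
  by rewrite par_in // inE.
- by move=> x /negPf xB; rewrite ffunE xB.
- exact: par_j.
- move=> x y; rewrite /lo /hi.
  case: (arc x) => [[_ [_ ->]]|->]; case: (arc y) => [[_ [_ ->]]|->]; try lia.
  exact: (rt_noncrossing Hg).
(* An edge of the branch passing over [j] would cross the chord from [j] to [r], as [r] lies on one
   side of the whole branch. *)
- move=> x; rewrite /lo /hi; case: (arc x) => [[xB [xj ->]]|->]; last by lia.
  have := sepr _ xB; have := sepr _ (branch_closed xB xj).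
  have := rt_noncrossing Hg (x := x) (y := j).
  have := rt_noncrossing Hg (x := j) (y := x).
  by rewrite /lo /hi pj; lia.
- move=> x; case: (arc x) => [[xB [xj ->]]|->]; last by rewrite ltnn.
  by rewrite !lbl_in ?branch_closed //; apply: (rt_label Hg).
Qed.

Lemma cut_rest_tree : rooted_tree_spec (V :\: branch) r cut_rest.
Proof.
have rV : r \in V :\: branch by rewrite in_setD root_branch (rt_root Hg).
have at_out x : x \notin branch -> cut_rest x = g x.
  by move=> /negPf xB; rewrite ffunE xB.
have par_out x : x \notin branch -> par cut_rest x = par g x.
  by move=> xB; rewrite /par at_out.
have lbl_out x : x \notin branch -> lbl cut_rest x = lbl g x.
  by move=> xB; rewrite /lbl at_out.
have arc x : [\/ x \notin branch /\ par cut_rest x = par g x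
               | par cut_rest x = x].
  have [xB|xB] := boolP (x \in branch); last by left; rewrite par_out.
  by right; rewrite /par ffunE xB.
have par_branch x : x \notin branch -> par g x \notin branch.
  by apply: contra; apply: branch_par.
split.
- exact: rV.
- move=> x; rewrite !in_setD => /andP[xB xV].
  by rewrite par_out // par_branch // (rt_closed Hg).
- move=> x; rewrite in_setD => /andP[xB xV]; have := rt_connect Hg xV.
  move: xB => /[swap]; elim/fconnect_ind: x / {xV}; first by [].
  move=> x xr _ IH xB; apply: connect_trans (fconnect1 _ _) _.
  by rewrite par_out //; apply: IH; apply: par_branch.
- move=> x; rewrite in_setD negb_and negbK => /orP[xB|xV]; first by rewrite ffunE xB.
  by rewrite ffunE (rt_outside Hg) // if_same.
- by rewrite par_out ?root_branch // (rt_par_root Hg).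
- move=> x y; rewrite /lo /hi.
  case: (arc x) => [[_ ->]|->]; case: (arc y) => [[_ ->]|->]; try lia.
  exact: (rt_noncrossing Hg).
- move=> x; rewrite /lo /hi; case: (arc x) => [[xB ->]|->]; last by lia.
  exact: (rt_uncovered Hg).
- move=> x; case: (arc x) => [[xB ->]|->]; last by rewrite ltnn.
  by rewrite !lbl_out ?par_branch //; apply: (rt_label Hg).
Qed.

Lemma cut_attach : attach branch r j cut_rest cut_branch = g.
Proof.
apply/ffunP => x; rewrite ffunE; case: ifP => xB; last by rewrite ffunE xB.
case: eqP => [->|xj].
  by rewrite ffunE mem_branch eqxx /= -pj /par /lbl; case: (g j).
by rewrite ffunE xB; case: eqP.
Qed.

(* A path from [y] to the root that avoids the branch leaves the open segment
   between x and j through an edge that every path from x to j must cross. *)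
Lemma branch_convex (x y : vertex) : x \in branch ->
    (r < x /\ x < j) \/ (j < x /\ x < r) ->
    (x < y /\ y < j) \/ (j < y /\ y < x) -> y \in V -> y \in branch.
Proof.
move=> xB hxr hy yV; apply/negPn/negP => yB.
pose A := [pred z : 'I_n | (((x < z) && (z < j)) || ((j < z) && (z < x)))
                    && (z \notin branch)].
have Ay : A y by rewrite /= yB andbT; lia.
have Ar : ~~ A r by rewrite /= root_branch andbT; lia.
have [u] := fconnect_exit (rt_connect Hg yV) Ay Ar.
rewrite /= => /andP[hu uB]; have puB : par g u \notin branch.
  by apply: contra uB; apply: branch_par.
rewrite puB andbT => hpu.
have nx : par g u != x by apply: contraNneq puB => ->.
have nj : par g u != j by apply: contraNneq puB => ->; rewrite mem_branch.
have Nju : ~ crosses j r u (par g u).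
  by have := rt_noncrossing Hg (x := j) (y := u); rewrite /lo /hi pj.
have Nuj : ~ crosses u (par g u) j r.
  by have := rt_noncrossing Hg (x := u) (y := j); rewrite /lo /hi pj.
have /andP[hlo jlo] := chord_separates hxr hu nx nj hpu Nju Nuj.
pose A' := [pred z : 'I_n | (lo g u < z < hi g u) && (z \in branch)].
have A'x : A' x by rewrite /= hlo xB.
have A'j : ~~ A' j by rewrite /= negb_and jlo.
have xj : fconnect (par g) x j by rewrite inE in xB.
have [z] := fconnect_exit xj A'x A'j.
rewrite /= => /andP[hz zB].
have [zj|zj] := eqVneq z j.
  by move: hz jlo; rewrite zj /lo /hi => ->.
have pzB := branch_closed zB zj.
rewrite pzB andbT => hpz.
have n1 : par g z != u by apply: contraNneq uB => <-.
have n2 : par g z != par g u by apply: contraNneq puB => <-.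
have [] := chord_exit hz hpz n1 n2; exact: (rt_noncrossing Hg).
Qed.

End Cut.

(** * Extreme branches of a tree on an interval *)

Section Intervals.
Variables (n k : nat).
Local Notation vertex := 'I_n.
Local Notation labelled := {ffun vertex -> vertex * 'I_k.+1}.

Definition vseg (a b : nat) : {set vertex} := [set x : vertex | a <= x <= b].

Lemma in_vseg a b (x : vertex) : (x \in vseg a b) = (a <= x <= b).
Proof. by rewrite inE. Qed.

Lemma vseg_split_low a b i : a <= i < b -> vseg a b :\: vseg a i = vseg i.+1 b.
Proof. by move=> h; apply/setP => x; rewrite in_setD !in_vseg; lia. Qed.

Lemma vseg_split_high a b i : a <= i < b -> vseg a b :\: vseg i.+1 b = vseg a i.
Proof. by move=> h; apply/setP => x; rewrite in_setD !in_vseg; lia. Qed.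

Lemma vseg_join a b i : a <= i < b -> vseg a b = vseg a i :|: vseg i.+1 b.
Proof. by move=> h; apply/setP => x; rewrite in_setU !in_vseg; lia. Qed.

Lemma vseg_separated a b i : separated (vseg a i) (vseg i.+1 b).
Proof. by left => x y; rewrite !in_vseg; lia. Qed.

Lemma vseg_separated_sym a b i : separated (vseg i.+1 b) (vseg a i).
Proof. by right => x y; rewrite !in_vseg; lia. Qed.

Variables (a b : nat) (r : vertex) (g : labelled).
Hypothesis Hg : rooted_tree_spec (vseg a b) r g.
Hypothesis bn : b < n.

Let rV : a <= r <= b. Proof. by rewrite -in_vseg; apply: (rt_root Hg). Qed.

Let parV (x : vertex) : a <= x <= b -> a <= par g x <= b.
Proof. by rewrite -!in_vseg; apply: (rt_closed Hg). Qed.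

(** Take the child farthest from the root. A path from a vertex beyond it can neither step to the
    root directly nor cross the chord from the root to that child, so it runs into the branch;
    convexity fills in the vertices on the near side of the child. *)
Lemma exists_right_branch : r = a :> nat -> a < b ->
  exists (j : vertex) (i : nat),
    [/\ j != r, par g j = r, a <= i < b & branch j g = vseg i.+1 b].
Proof.
move=> ra ab; pose vb := Ordinal bn.
have vbV : vb \in vseg a b by rewrite in_vseg /=; lia.
have vbr : predC1 r vb by rewrite /= -val_eqE /= ra; lia.
have [|u /= ur] := fconnect_exit (rt_connect Hg vbV) vbr.
  by rewrite /= eqxx.
rewrite negbK => /eqP pu.
pose P := [pred j : vertex | (j != r) && (par g j == r)].
have Pu : P u by rewrite /= ur pu eqxx.
case: (@arg_maxnP _ u P (fun j => j) Pu) => j /andP[jr /eqP pj] jmax.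
have jV : a <= j <= b by rewrite -in_vseg; apply: (child_in Hg jr pj).
have rj : r < j by move: jr; rewrite -val_eqE /=; lia.
have right_in (x : vertex) : j < x -> x \in vseg a b -> x \in branch j g.
  move=> jx xV; have := rt_connect Hg xV; move: jx xV.
  move=> /[swap] xV /[swap]; move: xV => /[swap].
  elim/fconnect_ind: x /; first by lia.
  move=> x xr _ IH xV jx; apply: branch_par.
  have pV : a <= par g x <= b by apply: parV; rewrite -in_vseg.
  have [pxj|pxj] := eqVneq (par g x) j; first by rewrite pxj mem_branch.
  have [pxr|pxr] := eqVneq (par g x) r.
    by have := jmax x; rewrite /= xr pxr eqxx => /(_ isT); lia.
  apply: IH; first by rewrite in_vseg.
  have := rt_noncrossing Hg (x := j) (y := x); rewrite /lo /hi pj.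
  move: pxj pxr; rewrite -!val_eqE /=.
  rewrite (minn_idPr (ltnW rj)) (maxn_idPl (ltnW rj)).
  by case: (leqP x (par g x)) => h; lia.
case: (arg_minnP (fun x : vertex => x : nat) (mem_branch j g)) => m mB mmin.
have mV : a <= m <= b by rewrite -in_vseg; apply: (subsetP (branch_sub Hg jr pj)).
have mr : m != r by apply: contraNneq (root_branch Hg jr) => <-.
have mj : m <= j by apply: mmin; apply: mem_branch.
(* The branch begins at its least vertex [m], which exceeds [a] because the root [a] is not in the
   branch. *)
exists j, m.-1; rewrite -val_eqE /= in mr; split=> //; first by lia.
have -> : m.-1.+1 = m by lia.
apply/setP => x; rewrite in_vseg; apply/idP/idP => [xB|hx].
  have := subsetP (branch_sub Hg jr pj) x xB; rewrite in_vseg => /andP[_ ->].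
  by rewrite mmin.
have [xj|xj|xj] := ltngtP x j; first last.
- by rewrite (val_inj xj) mem_branch.
- by apply: right_in => //; rewrite in_vseg; lia.
have [xm|xm] := eqVneq x m; first by rewrite xm.
rewrite -val_eqE /= in xm.
by apply: (branch_convex Hg jr pj mB); rewrite ?in_vseg; lia.
Qed.

(** No edge passes over [r], so a path from the left end arrives at [r] from a child on its left.
    The leftmost such child has an initial segment as its branch. *)
Lemma exists_left_branch : a < r ->
  exists (j : vertex) (i : nat),
    [/\ j != r, par g j = r, a <= i < r & branch j g = vseg a i].
Proof.
move=> ar; have an : a < n by lia.
pose va := Ordinal an.
have vaV : va \in vseg a b by rewrite in_vseg /=; lia.
have [||u /= ur] := @fconnect_exit _ _ [pred z : vertex | z < r] va r
  (rt_connect Hg vaV).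
- exact: ar.
- by rewrite /= ltnn.
rewrite -leqNgt => pur.
have pu : par g u = r.
  apply: val_inj => /=; have := rt_uncovered Hg (x := u); rewrite /lo /hi.
  by rewrite (minn_idPl _) ?(maxn_idPr _); lia.
pose P := [pred j : vertex | (j < r) && (par g j == r)].
have Pu : P u by rewrite /= ur pu eqxx.
case: (@arg_minnP _ u P (fun j => j) Pu) => j /andP[jr' /eqP pj] jmin.
have jr : j != r by rewrite -val_eqE /=; lia.
have jV : a <= j <= b by rewrite -in_vseg; apply: (child_in Hg jr pj).
have left_in (x : vertex) : x < j -> x \in vseg a b -> x \in branch j g.
  move=> jx xV; have := rt_connect Hg xV; move: jx xV.
  move=> /[swap] xV /[swap]; move: xV => /[swap].
  elim/fconnect_ind: x /; first by lia.
  move=> x xr _ IH xV jx; apply: branch_par.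
  have pV : a <= par g x <= b by apply: parV; rewrite -in_vseg.
  have [pxj|pxj] := eqVneq (par g x) j; first by rewrite pxj mem_branch.
  have [pxr|pxr] := eqVneq (par g x) r.
    have := jmin x; rewrite /= pxr eqxx andbT => H.
    by have := H (ltn_trans jx jr'); lia.
  apply: IH; first by rewrite in_vseg.
  have := rt_noncrossing Hg (x := x) (y := j); rewrite /lo /hi pj.
  have := rt_uncovered Hg (x := x); rewrite /lo /hi.
  move: pxj pxr; rewrite -!val_eqE /=.
  rewrite (minn_idPl (ltnW jr')) (maxn_idPr (ltnW jr')).
  by case: (leqP x (par g x)) => h; lia.
(* A branch with vertices on both sides of [r] would contain an edge over the root. *)
have below (x : vertex) : x \in branch j g -> x < r.
  move=> xB; have rB := root_branch Hg jr.
  have xr : x != r by apply: contraNneq rB => <-.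
  rewrite ltnNge; apply/negP => rx.
  have xj : fconnect (par g) x j by rewrite inE in xB.
  have [||z /andP[rz zB]] := @fconnect_exit _ _
     [pred z : vertex | (r < z) && (z \in branch j g)] x j xj.
  - by rewrite /= xB andbT; move: xr; rewrite -val_eqE /=; lia.
  - by rewrite /= negb_and -leqNgt (ltnW jr').
  have zj : z != j by rewrite -val_eqE /=; lia.
  have pzB := branch_closed zB zj.
  rewrite /= pzB andbT -leqNgt => pzr.
  have pz : par g z != r by apply: contraNneq rB => <-.
  have := rt_uncovered Hg (x := z); rewrite /lo /hi; move: pz.
  rewrite -val_eqE /= => pz.
  by rewrite (minn_idPr _) ?(maxn_idPl _); lia.
case: (arg_maxnP (fun x : vertex => x : nat) (mem_branch j g)) => m mB mmax.
have mV : a <= m <= b by rewrite -in_vseg; apply: (subsetP (branch_sub Hg jr pj)).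
have mr := below m mB.
have mj : j <= m by apply: mmax; apply: mem_branch.
exists j, m; split=> //; first by lia.
apply/setP => x; rewrite in_vseg; apply/idP/idP => [xB|hx].
  have := subsetP (branch_sub Hg jr pj) x xB; rewrite in_vseg => /andP[-> _].
  exact: mmax.
have [xj|xj|xj] := ltngtP x j; last by rewrite (val_inj xj) mem_branch.
  by apply: left_in => //; rewrite in_vseg; lia.
have [xm|xm] := eqVneq x m; first by rewrite xm.
rewrite -val_eqE /= in xm.
by apply: (branch_convex Hg jr pj mB); rewrite ?in_vseg; lia.
Qed.

End Intervals.

(** * Edge sets *)

Section ParentFunctions.
Variable n : nat.
Local Notation vertex := 'I_n.+1.
Implicit Types (p q : vertex -> vertex) (x y : vertex).

(** [ord0] is left out: being its own parent, it would contribute a singleton. *)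
Definition edges_of p : {set {set vertex}} :=
  [set [set x; p x] | x in predC1 ord0].

Definition parent_fun p : Prop :=
  p ord0 = ord0 /\ forall x, fconnect p x ord0.

Lemma adjC m (E : {set {set 'I_m}}) : ssrbool.symmetric (adj E).
Proof. by move=> x y; rewrite /adj setUC. Qed.

Lemma adj_edges p x y : adj (edges_of p) x y
  = ((x != ord0) && (p x == y)) || ((y != ord0) && (p y == x)).
Proof.
apply/imsetP/idP => [[z z0 E]|/orP[]/andP[x0 /eqP <-]]; last first.
- by exists y => //; rewrite setUC.
- by exists x.
have xz : x \in [set z; p z] by rewrite -E set21.
have yz : y \in [set z; p z] by rewrite -E set22.
have zx : z \in [set x; y] by rewrite E set21.
have pz : p z \in [set x; y] by rewrite E set22.
move: z0 xz yz zx pz; rewrite !inE => z0.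
case: (eqVneq x z) => [->|xz] /=; case: (eqVneq y z) => [->|yz] //=.
- by rewrite z0 orbb => _ _ _ ->.
- by rewrite z0 => _ /eqP ->; rewrite eqxx.
- by rewrite z0 => /eqP ->; rewrite eqxx orbT.
Qed.

Section Acyclic.
Variable p : vertex -> vertex.
Hypothesis pp : parent_fun p.

Definition depth x : nat := findex p x ord0.

Lemma depth_par x : x != ord0 -> depth x = (depth (p x)).+1.
Proof. by move=> x0; apply: fconnect_findex; [apply: (proj2 pp) | rewrite eq_sym]. Qed.

Lemma par_neq x : x != ord0 -> p x != x.
Proof. by move=> x0; apply/eqP => E; have := depth_par x0; rewrite E; lia. Qed.

Lemma edges_graph : is_graph (edges_of p).
Proof.
apply/forall_inP => e /imsetP[x x0 ->]; rewrite cards2.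
by rewrite [x == _]eq_sym par_neq.
Qed.

Lemma edges_connect_root x : connect (adj (edges_of p)) x ord0.
Proof.
elim/fconnect_ind: x / (proj2 pp x) => [|x x0 _ IH]; first exact: connect0.
by apply: connect_trans IH; apply: connect1; rewrite adj_edges x0 eqxx.
Qed.

Lemma edges_connect x y : connect (adj (edges_of p)) x y.
Proof.
apply: connect_trans (edges_connect_root x) _.
by rewrite (sym_connect_sym (@adjC _ _)) edges_connect_root.
Qed.

Lemma edges_connected : connected_graph (edges_of p).
Proof. by apply/forallP => x; apply/forallP => y; apply: edges_connect. Qed.

(* Both neighbours on a cycle of a vertex of maximal depth are its parent. *)
Lemma edges_acyclic : acyclic_graph (edges_of p).
Proof.
apply/forallP => m; apply/forallP => -[c /= /eqP sc].
apply/implyP => m2; apply/negP => /andP[cyc un].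
have [x0 x0c] : exists x, x \in c.
  by case: (c) sc m2 => [<-//|x s _ _]; exists x; rewrite mem_head.
case: (@arg_maxnP _ x0 (mem c) depth x0c) => x xc xmax.
have {}xmax y : y \in c -> depth y <= depth x by move/xmax.
have [i c' Ec] := rot_to xc.
have := cyc; rewrite -(rot_cycle i) Ec; have := un; rewrite -(rot_uniq i) Ec.
have sc' : size (x :: c') = m by rewrite -Ec size_rot.
have sub y : y \in c' -> y \in c.
  by move=> yc; rewrite -(mem_rot i) Ec inE yc orbT.
have par_of y : y \in c' -> adj (edges_of p) x y -> p x = y.
  move=> yc; rewrite adj_edges => /orP[/andP[_ /eqP]//|/andP[y0 /eqP E]].
  by have := xmax y (sub y yc); rewrite (depth_par y0) E ltnn.
case: c' sc' sub par_of {Ec} => [|a [|b s]] /= sc' sub par_of; try lia.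
move=> /and3P[_ ab _] /and3P[xa _]; rewrite rcons_path => /andP[_ bx].
have pa : p x = a by apply: par_of => //; rewrite mem_head.
have pb : p x = last b s.
  by apply: par_of; rewrite 1?adjC // inE mem_last orbT.
by move: ab; rewrite -pa pb mem_last.
Qed.

Lemma path_enter (e : rel vertex) (A : pred vertex) x s :
    path e x s -> ~~ A x -> A (last x s) ->
  exists u v, [/\ e u v, ~~ A u, A v & v \in s].
Proof.
elim: s x => [|y s IH] x /= => [_ /negPf -> //|/andP[xy ys] Ax Al].
have [Ay|Ay] := boolP (A y); first by exists x, y; rewrite mem_head.
have [u [v [uv Au Av vs]]] := IH y ys Ay Al.
by exists u, v; rewrite inE vs orbT.
Qed.

(** Otherwise [j] is the parent of [i]. The part of the path that leads from the root to [i] then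
    enters the set of descendants of [j], which is possible only through [j]; so the simple path
    visits [j] before [i] and again at its end. *)
Lemma on_root_path_par i j : adj (edges_of p) i j -> i != j -> j != ord0 ->
  on_root_path (edges_of p) i j -> p j = i.
Proof.
rewrite adj_edges => /orP[/andP[i0 /eqP pi]|/andP[_ /eqP //]] ij j0.
move=> /existsP[r /andP[/eqP r0 /existsP[m /existsP[[s s_m] /=]]]].
move=> /and4P[ps us /eqP ls irs].
have {r0} r0 : r = ord0 by apply: val_inj.
subst r.
have i_s : i \in s by move: irs; rewrite inE (negPf i0).
move: ps us ls {irs}; case/splitPr: i_s => s1 s2.
rewrite -cat_rcons cat_path last_cat last_rcons => /andP[ps _] us ls.
pose A := [pred z | fconnect p z j].
have A0 : ~~ A ord0.
  by apply/negP => /(fconnect_fix (proj1 pp)) E; rewrite E eqxx in j0.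
have Ai : A (last ord0 (rcons s1 i)) by rewrite last_rcons /= -pi fconnect1.
have [u [v [uv Au Av vs]]] := path_enter ps A0 Ai.
have vj : v != j.
  apply: contraTneq us => E; rewrite -ls in E.
  case: s2 ls E => [|b s2] /= ls E; first by rewrite ls eqxx in ij.
  rewrite negb_and cat_uniq; apply/orP; right; rewrite !negb_and negbK.
  apply/orP; right; apply/orP; left; apply/hasP; exists v => //.
  by rewrite E mem_last.
move: uv; rewrite adj_edges => /orP[/andP[_ /eqP E]|/andP[_ /eqP E]].
  by move: Au; rewrite /= (connect_trans (fconnect1 p u)) // E.
by move: Au; rewrite /= -E fconnect_step.
Qed.

(** The bound on the depths guarantees that the path stays simple when it is extended by a child of
    [x]. *)
Lemma root_path x : exists s, [/\ path (adj (edges_of p)) ord0 s,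
  uniq (ord0 :: s), last ord0 s = x & forall y, y \in ord0 :: s -> depth y <= depth x].
Proof.
elim/fconnect_ind: x / (proj2 pp x) => [|x x0 _ [s [ps us ls ds]]].
  by exists [::]; split=> // y; rewrite inE => /eqP ->.
have xs : x \notin ord0 :: s.
  by apply/negP => /ds; rewrite (depth_par x0) ltnn.
exists (rcons s x); split; last 2 first.
- by rewrite last_rcons.
- move=> y; rewrite -rcons_cons mem_rcons inE => /orP[/eqP -> //|/ds].
  by rewrite (depth_par x0) => /leqW.
- by rewrite rcons_path ps ls adj_edges x0 eqxx orbT.
- by rewrite -rcons_cons rcons_uniq xs.
Qed.

Lemma par_on_root_path x : x != ord0 -> on_root_path (edges_of p) (p x) x.
Proof.
move=> x0; have [s [ps us ls ds]] := root_path (p x).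
have xs : x \notin ord0 :: s.
  by apply/negP => /ds; rewrite (depth_par x0) ltnn.
apply/existsP; exists ord0; rewrite /is_root /=.
have us' : uniq (ord0 :: rcons s x) by rewrite -rcons_cons rcons_uniq xs.
have ss : size (rcons s x) < n.+1.
  by have := max_card (mem (ord0 :: rcons s x)); rewrite (card_uniqP us') card_ord.
apply/existsP; exists (Ordinal ss); apply/existsP; exists (in_tuple (rcons s x)).
rewrite /= in us'; rewrite /= us' last_rcons eqxx rcons_path ps ls /=.
rewrite adj_edges x0 eqxx orbT /=.
have := mem_last ord0 s; rewrite ls !inE mem_rcons inE.
by case/orP => ->; rewrite ?orbT.
Qed.

End Acyclic.

(** If [q] directed the edge between [x] and [p x] away from the root, then [x] would be the parent
    of [p x] under [q], hence by induction also under [p], against the depths. *)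
Lemma edges_of_inj p q : parent_fun p -> parent_fun q ->
  edges_of p = edges_of q -> p =1 q.
Proof.
move=> Hp Hq E x.
elim/fconnect_ind: x / (proj2 Hp x) => [|x x0 _ IH].
  by rewrite (proj1 Hp) (proj1 Hq).
have : adj (edges_of p) x (p x) by rewrite adj_edges x0 eqxx.
rewrite E adj_edges => /orP[/andP[_ /eqP //]|/andP[px0]].
rewrite -IH => /eqP px.
by have := depth_par Hp x0; have := depth_par Hp px0; rewrite px; lia.
Qed.

(** * The parent function of a given tree *)

Section Tree.
Variable E : {set {set vertex}}.
Hypothesis treeE : is_tree E.

Let steps (m : nat) x : bool :=
  [exists s : m.-tuple vertex, path (adj E) ord0 s && (last ord0 s == x)].

Let steps_ex x : exists m, steps m x.
Proof.
have /and3P[_ /forallP/(_ ord0)/forallP/(_ x) /connectP[s ps ls] _] := treeE.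
exists (size s); apply/existsP; exists (in_tuple s).
by rewrite ps ls eqxx.
Qed.

Let dist x : nat := ex_minn (steps_ex x).

Let closer x : x != ord0 -> exists y, adj E x y && (dist y < dist x).
Proof.
move=> x0; rewrite [dist x]/dist; case: ex_minnP => m.
move=> /existsP[[s /= /eqP sm] /andP[ps /eqP ls]] _.
case/lastP: s sm ps ls => [|s y] sm; first by move=> _ E0; rewrite -E0 eqxx in x0.
rewrite rcons_path last_rcons => /andP[ps yl] yx; subst y.
exists (last ord0 s); rewrite adjC yl /dist /=; case: ex_minnP => m' _ min.
rewrite -sm size_rcons ltnS; apply: min; apply/existsP.
by exists (in_tuple s); rewrite /= ps eqxx.
Qed.

(** A neighbour nearer to the root, for the length of shortest walks from [ord0]; one always exists
    for [x != ord0], so the default of [odflt] is never taken. *)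
Definition tree_parent x : vertex :=
  if x == ord0 then ord0
  else odflt ord0 [pick y | adj E x y && (dist y < dist x)].

Let tree_parentP x : x != ord0 ->
  adj E x (tree_parent x) && (dist (tree_parent x) < dist x).
Proof.
move=> x0; rewrite /tree_parent (negPf x0); case: pickP => //= H.
by have [y] := closer x0; rewrite H.
Qed.

Lemma tree_parent_fun : parent_fun tree_parent.
Proof.
split=> [|x]; first by rewrite /tree_parent eqxx.
elim: {x}(dist x).+1 {-2}x (ltnSn (dist x)) => // d IH x xd.
have [->|x0] := eqVneq x ord0; first exact: connect0.
apply: connect_trans (fconnect1 _ _) _; apply: IH.
by have /andP[_ lt] := tree_parentP x0; apply: leq_trans lt _.
Qed.

(** The edges to the parents already connect all vertices, so any further edge would close a cycle
    with the path between its ends. *)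
Lemma tree_parent_edges : edges_of tree_parent = E.
Proof.
have sub x y : adj (edges_of tree_parent) x y -> adj E x y.
  by rewrite adj_edges => /orP[]/andP[/tree_parentP/andP[h _] /eqP <-]; rewrite // adjC.
apply/eqP; rewrite eqEsubset; apply/andP; split; apply/subsetP => e.
  by move=> /imsetP[x x0 ->]; have /andP[] := tree_parentP x0.
move=> eE; have [/forall_inP isg _ ac] := and3P treeE.
have /cards2P[u [v [uv Ee]]] := isg e eE.
rewrite Ee -/(adj _ u v); apply/negPn/negP => nadj.
have /connectP[s ps ls] := edges_connect tree_parent_fun u v.
move: ls; case/shortenP: ps => {}s ps us _ ls.
have ss : size (u :: s) < n.+2.
  by have := max_card (mem (u :: s)); rewrite (card_uniqP us) card_ord.
have /forallP/(_ (Ordinal ss))/forallP/(_ (in_tuple (u :: s))) := ac.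
have s2 : 1 < size s.
  case: s ps ls {us ss} => [_ /= E0|y [|//]]; first by rewrite E0 eqxx in uv.
  by rewrite /= andbT => h E0; rewrite E0 h in nadj.
rewrite /= ltnS s2 /= /ucycleb us andbT /= rcons_path (sub_path sub ps) -ls.
by rewrite adjC /adj -Ee eE.
Qed.

End Tree.
End ParentFunctions.

(** * Correspondence between labelled edge sets and parent functions *)

Section EdgeSets.
Variables (n k : nat).
Local Notation vertex := 'I_n.+1.
Local Notation labelled := {ffun vertex -> vertex * 'I_k.+1}.
Implicit Types (g : labelled) (x y : vertex).

Local Notation full := (vseg n.+1 0 n).

Definition labelling g : {ffun vertex -> 'I_k.+1} := [ffun x => lbl g x].

Definition edge_labelling g : {set {set vertex}} * {ffun vertex -> 'I_k.+1} :=
  (edges_of (par g), labelling g).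

Lemma in_full x : x \in full.
Proof. by rewrite in_vseg leq0n leq_ord. Qed.

Lemma rooted_tree_parent_fun g :
  rooted_tree_spec full ord0 g -> parent_fun (par g).
Proof.
move=> T; split=> [|x]; first exact: (rt_par_root T).
by apply: (rt_connect T); apply: in_full.
Qed.

Lemma edge_labelling_inj :
  {in [pred g | rooted_tree full ord0 g] &, injective edge_labelling}.
Proof.
move=> g g' /rooted_treeP /rooted_tree_parent_fun P.
move=> /rooted_treeP /rooted_tree_parent_fun P' [E /ffunP L].
apply/ffunP => x; have := edges_of_inj P P' E x; have := L x.
by rewrite !ffunE /par /lbl; case: (g x) (g' x) => [? ?] [? ?] /= -> ->.
Qed.

Lemma edge_labelling_tree g : rooted_tree_spec full ord0 g ->
  is_labelling (labelling g) ->
  k_noncrossing_tree (edge_labelling g).1 (edge_labelling g).2.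
Proof.
move=> T Lg; have P := rooted_tree_parent_fun T.
apply/and4P; split=> //.
- by apply/and3P; split; [apply: edges_graph|apply: edges_connected|apply: edges_acyclic].
- apply/forallP => a; apply/forallP => b; apply/forallP => c; apply/forallP => d.
  rewrite !adj_edges; apply/negP => /and5P[ab cd ac cb bd].
  have N x y := rt_noncrossing T (x := x) (y := y).
  case/orP: ab => /andP[_ /eqP Eab]; case/orP: cd => /andP[_ /eqP Ecd].
  - by apply: (N a c); rewrite /lo /hi Eab Ecd; lia.
  - by apply: (N a d); rewrite /lo /hi Eab Ecd; lia.
  - by apply: (N b c); rewrite /lo /hi Eab Ecd; lia.
  - by apply: (N b d); rewrite /lo /hi Eab Ecd; lia.
- apply/forallP => i; apply/forallP => j; apply/implyP => /and3P[ij lt_ij rij].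
  have jn : i != j by rewrite -val_eqE /=; lia.
  have j0 : j != ord0 by rewrite -val_eqE /=; lia.
  have E := on_root_path_par P ij jn j0 rij.
  by have := rt_label T (x := j); rewrite E !ffunE; apply.
Qed.

Lemma edge_labelling_surj (E : {set {set vertex}})
    (f : {ffun vertex -> 'I_k.+1}) : k_noncrossing_tree E f ->
  exists2 g, rooted_tree_spec full ord0 g & edge_labelling g = (E, f).
Proof.
move=> /and4P[treeE ncE Lf /forallP bound].
pose p := tree_parent treeE; pose g : labelled := [ffun x => (p x, f x)].
have P : parent_fun p := tree_parent_fun treeE.
have Ep : edges_of p = E := tree_parent_edges treeE.
have parE x : par g x = p x by rewrite /par ffunE.
have lblE x : lbl g x = f x by rewrite /lbl ffunE.
have adjp x : x != ord0 -> adj E x (p x) /\ adj E (p x) x.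
  by move=> x0; rewrite -Ep !adj_edges x0 eqxx orbT.
exists g; last first.
  congr (_, _); last by apply/ffunP => x; rewrite ffunE lblE.
  rewrite -Ep; apply/setP => e.
  by apply/imsetP/imsetP => -[x x0 ->]; exists x; rewrite ?parE.
split.
- exact: in_full.
- by move=> x _; apply: in_full.
- move=> x _; rewrite (eq_fconnect parE); exact: (proj2 P).
- by move=> x; rewrite in_full.
- by rewrite parE (proj1 P).
- move=> x y; rewrite /lo /hi !parE => -[h1 [h2 h3]].
  have x0 : x != ord0.
    by apply/eqP => E0; move: h1 h2; rewrite E0 (proj1 P); lia.
  have y0 : y != ord0.
    by apply/eqP => E0; move: h1 h2; rewrite E0 (proj1 P) /=; lia.
  have [x1 x2] := adjp x x0; have [y1 y2] := adjp y y0.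
  have N a b c d : adj E a b -> adj E c d -> a < c -> c < b -> b < d -> False.
    move=> ab cd ac cb bd; move: ncE => /forallP/(_ a)/forallP/(_ b).
    by move=> /forallP/(_ c)/forallP/(_ d); rewrite ab cd ac cb bd.
  move: h1 h2 h3; case: (leqP x (p x)) => hx; case: (leqP y (p y)) => hy h1 h2 h3.
  + exact: (N _ _ _ _ x1 y1).
  + exact: (N _ _ _ _ x1 y2).
  + exact: (N _ _ _ _ x2 y1).
  + exact: (N _ _ _ _ x2 y2).
- by move=> x [] /=; rewrite ltn0.
- move=> x; rewrite parE !lblE => px.
  have x0 : x != ord0 by apply: contraTneq px => ->.
  have /forallP/(_ x)/implyP := bound (p x); apply.
  by rewrite px (proj2 (adjp x x0)) -Ep par_on_root_path.
Qed.

Lemma card_k_noncrossing (Q : pred {ffun vertex -> 'I_k.+1}) :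
  #|[set t : {set {set vertex}} * {ffun vertex -> 'I_k.+1} |
       k_noncrossing_tree t.1 t.2 && Q t.2]|
  = #|[set g : labelled | [&& rooted_tree full ord0 g,
         is_labelling (labelling g) & Q (labelling g)]]|.
Proof.
rewrite -(card_in_imset (f := edge_labelling)); last first.
  move=> g g'; rewrite !inE => /andP[Tg _] /andP[Tg' _].
  exact: edge_labelling_inj.
apply: eq_card => -[E f]; rewrite inE /=; apply/andP/imsetP => [[Tt Qf]|].
  have [g Tg Eg] := edge_labelling_surj Tt.
  exists g => //; rewrite inE; have [_ Ef] := Eg.
  rewrite Ef Qf andbT; have /and4P[_ _ -> _] := Tt; rewrite andbT.
  exact/rooted_treeP.
move=> [g]; rewrite inE => /and3P[/rooted_treeP Tg Lg Qg] Eg.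
have := edge_labelling_tree Tg Lg; rewrite -Eg /= => ->.
by have [_ ->] := Eg.
Qed.

End EdgeSets.

Import Order.TTheory GRing.Theory Num.Theory.
Local Open Scope ring_scope.

(** * Weighted enumeration *)

Section WeightedCount.
Import GRing.Theory.
Local Open Scope ring_scope.
Variables (n k : nat) (R : comPzRingType) (wt : 'I_k.+1 -> R).
Local Notation vertex := 'I_n.
Local Notation labelled := {ffun vertex -> vertex * 'I_k.+1}.

Definition trees (a b : nat) : {set vertex * labelled} :=
  [set y | rooted_tree (vseg n a b) y.1 y.2].

Definition root_lbl (y : vertex * labelled) : 'I_k.+1 := lbl y.2 y.1.

Definition weight (a b : nat) (g : labelled) : R :=
  \prod_(x in vseg n a b) wt (lbl g x).

(** The root may be any vertex of the interval, with a tree on each side: these are the coefficients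
    of B_c. Those of N_c are the [left_sum], where the root is the left end. *)
Definition inner_sum (c : 'I_k.+1) (a b : nat) : R :=
  \sum_(y in trees a b | root_lbl y == c) weight a b y.2.

Definition left_sum (c : 'I_k.+1) (a b : nat) : R :=
  \sum_(y in trees a b | (root_lbl y == c) && (y.1 == a :> nat)) weight a b y.2.

Lemma treesP a b y :
  reflect (rooted_tree_spec (vseg n a b) y.1 y.2) (y \in trees a b).
Proof. by rewrite inE; apply: rooted_treeP. Qed.

Lemma weight_split a b i g : (a <= i < b)%N ->
  weight a b g = weight a i g * weight i.+1 b g.
Proof.
move=> h; rewrite /weight -bigU.
  by apply: eq_bigl => x; rewrite (vseg_join _ h) !inE.
by rewrite disjoint_subset; apply/subsetP => x; rewrite !inE; lia.
Qed.

Lemma eq_weight a b g g' :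
    (forall x, x \in vseg n a b -> lbl g x = lbl g' x) ->
  weight a b g = weight a b g'.
Proof. by move=> H; apply: eq_bigr => x hx; rewrite H. Qed.

Local Notation triple :=
  ('I_n * ((vertex * labelled) * (vertex * labelled)))%type.

Section Glue.
Variables (a b : nat) (c : 'I_k.+1).
Hypothesis bn : (b < n)%N.

Definition glue_left (t : triple) : vertex * labelled :=
  (t.2.2.1, attach (vseg n a t.1) t.2.2.1 t.2.1.1 t.2.2.2 t.2.1.2).

Definition glue_right (t : triple) : vertex * labelled :=
  (t.2.1.1, attach (vseg n t.1.+1 b) t.2.1.1 t.2.2.1 t.2.1.2 t.2.2.2).

(** The child precedes its parent here, so its label is free. In [right_dom] it follows its parent
    and the sum of the two labels is bounded. *)
Definition left_dom : {set triple} :=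
  [set t : triple | [&& (a <= t.1 < b)%N, t.2.1 \in trees a t.1,
     t.2.2 \in trees t.1.+1 b & root_lbl t.2.2 == c]].

Definition right_dom : {set triple} :=
  [set t : triple | [&& (a <= t.1 < b)%N,
     [&& t.2.1 \in trees a t.1, root_lbl t.2.1 == c & t.2.1.1 == a :> nat]
     & (t.2.2 \in trees t.1.+1 b) && (c + root_lbl t.2.2 <= k.+1)%N]].

Definition left_weight (t : triple) : R :=
  weight a t.1 t.2.1.2 * weight t.1.+1 b t.2.2.2.

Lemma glue_left_weight t : t \in left_dom ->
  weight a b (glue_left t).2 = left_weight t.
Proof.
case: t => i [[j g1] [r g2]]; rewrite inE /= => /and4P[hi /treesP T1 /treesP T2 _].
rewrite (weight_split _ hi) /left_weight /=; congr (_ * _); apply: eq_weight => x.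
  exact: (attach_lbl_in' _ _ T1).
exact: (attach_lbl_in _ _ _ _ (vseg_separated_sym _ _ _ _)).
Qed.

Lemma glue_right_weight t : t \in right_dom ->
  weight a b (glue_right t).2 = left_weight t.
Proof.
case: t => i [[r g1] [j g2]]; rewrite inE /=.
move=> /and3P[hi /and3P[/treesP T1 _ _] /andP[/treesP T2 _]].
rewrite (weight_split _ hi) /left_weight /=; congr (_ * _); apply: eq_weight => x.
  exact: (attach_lbl_in _ _ _ _ (vseg_separated _ _ _ _)).
exact: (attach_lbl_in' _ _ T2).
Qed.

(** Identifies the extreme child in a glued tree as the one whose branch contains an end of the
    interval. *)
Lemma root_child_unique (p : vertex -> vertex) r j j' x : p r = r ->
    p j = r -> p j' = r -> j != r -> j' != r ->
  fconnect p x j -> fconnect p x j' -> j = j'.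
Proof.
move=> pr pj pj' jr jr' xj; have direct y z : p y = r -> z != r ->
    fconnect p y z -> y = z.
  move=> py zr yz; have [//|ne] := eqVneq y z.
  have := fconnect_step ne yz; rewrite py => /(fconnect_fix pr) E.
  by rewrite E eqxx in zr.
elim/fconnect_ind: x / xj => [|x xj xcj IH xj']; first exact: direct.
have [E|ne] := eqVneq x j'; last by apply: IH; apply: fconnect_step.
by rewrite E in xcj; rewrite (direct _ _ pj' jr xcj).
Qed.

Lemma glue_left_inj : {in left_dom &, injective glue_left}.
Proof.
move=> [i [[j g1] [r g2]]] [i' [[j' g1'] [r' g2']]].
rewrite !inE /= => /and4P[hi /rooted_treeP T1 /rooted_treeP T2 _].
move=> /and4P[hi' /rooted_treeP T1' /rooted_treeP T2' _] [/= Er].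
rewrite -{}Er in T2' *; set G := attach _ _ _ _ _ => EG.
have s := vseg_separated_sym n a b i.
have s' := vseg_separated_sym n a b i'.
have C x := attach_connectE T2 T1 s x; have C' x := attach_connectE T2' T1' s' x.
rewrite -/G in C; rewrite -EG -/G in C'.
have aV : (a < n)%N by lia.
have jj : j = j'.
  apply: (@root_child_unique (par G) r _ _ (Ordinal aV)).
  - by rewrite (attach_par_in _ _ _ _ s) ?(rt_root T2) // (rt_par_root T2).
  - exact: (attach_par_root' _ _ T1).
  - by rewrite EG; apply: (attach_par_root' _ _ T1').
  - have := rt_root T1; have := rt_root T2; rewrite !in_vseg -val_eqE /=; lia.
  - have := rt_root T1'; have := rt_root T2'; rewrite !in_vseg -val_eqE /=; lia.
  - by rewrite C in_vseg /=; lia.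
  - by rewrite C' in_vseg /=; lia.
have ii : i = i'.
  have H x : (x \in vseg n a i) = (x \in vseg n a i') by rewrite -C -C' jj.
  have := H i; have := H i'; rewrite !in_vseg => h1 h2.
  by apply: val_inj => /=; lia.
move: EG T1' T2' {s' C C'}; rewrite /G -jj -ii => EG T1' T2'.
by have [-> ->] := attach_inj s T2 T1 T2' T1' EG.
Qed.

Lemma glue_right_inj : {in right_dom &, injective glue_right}.
Proof.
move=> [i [[r g1] [j g2]]] [i' [[r' g1'] [j' g2']]].
rewrite !inE /= => /and3P[hi /and3P[/rooted_treeP T1 _ _] /andP[/rooted_treeP T2 _]].
move=> /and3P[hi' /and3P[/rooted_treeP T1' _ _] /andP[/rooted_treeP T2' _]] [/= Er].
rewrite -{}Er in T1' *; set G := attach _ _ _ _ _ => EG.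
have s := vseg_separated n a b i.
have s' := vseg_separated n a b i'.
have C x := attach_connectE T1 T2 s x; have C' x := attach_connectE T1' T2' s' x.
rewrite -/G in C; rewrite -EG -/G in C'.
have jj : j = j'.
  apply: (@root_child_unique (par G) r _ _ (Ordinal bn)).
  - by rewrite (attach_par_in _ _ _ _ s) ?(rt_root T1) // (rt_par_root T1).
  - exact: (attach_par_root' _ _ T2).
  - by rewrite EG; apply: (attach_par_root' _ _ T2').
  - have := rt_root T1; have := rt_root T2; rewrite !in_vseg -val_eqE /=; lia.
  - have := rt_root T1; have := rt_root T2'; have := rt_root T1'.
    by rewrite !in_vseg -val_eqE /=; lia.
  - by rewrite C in_vseg /=; lia.
  - by rewrite C' in_vseg /=; lia.
have ii : i = i'.
  have H x : (x \in vseg n i.+1 b) = (x \in vseg n i'.+1 b).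
    by rewrite -C -C' jj.
  have i1 : (i.+1 < n)%N by lia.
  have i1' : (i'.+1 < n)%N by lia.
  have := H (Ordinal i1); have := H (Ordinal i1'); rewrite !in_vseg /= => h1 h2.
  by apply: val_inj => /=; lia.
move: EG T1' T2' {s' C C'}; rewrite /G -jj -ii => EG T1' T2'.
by have [-> ->] := attach_inj s T1 T2 T1' T2' EG.
Qed.

Lemma glue_left_image : glue_left @: left_dom
  = [set y in trees a b | (root_lbl y == c) && (a < y.1)%N].
Proof.
apply/setP => -[r g]; rewrite !inE /=; apply/imsetP/idP.
  move=> [[i [[j g1] [r' g2]]]]; rewrite !inE /=.
  move=> /and4P[hi /rooted_treeP T1 /rooted_treeP T2 rc] [-> ->].
  have s := vseg_separated_sym n a b i.
  have rV := rt_root T2; have jV := rt_root T1; rewrite !in_vseg in rV jV.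
  apply/and3P; split; [|by rewrite /root_lbl /= (attach_lbl_in _ _ _ _ s) ?in_vseg|lia].
  apply/rooted_treeP; rewrite (vseg_join _ hi) setUC.
  by apply: attach_rooted_tree => //; lia.
move=> /and3P[/rooted_treeP T rc ar].
have [j [i [jr pj hi Eb]]] := exists_left_branch T bn ar.
have rV := rt_root T; rewrite in_vseg in rV.
have i_n : (i < n)%N by lia.
have hib : (a <= i < b)%N by lia.
have sep : separated (vseg n a b :\: branch j g) (branch j g).
  by rewrite Eb vseg_split_low //; apply: vseg_separated_sym.
have T1 := cut_branch_tree T jr pj sep; have T2 := cut_rest_tree T jr.
have EG := cut_attach pj.
exists (Ordinal i_n, ((j, cut_branch j g), (r, cut_rest j g))); last first.
  by rewrite /glue_left /= -Eb EG.
rewrite Eb vseg_split_low // in T2; rewrite !inE /= hib.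
apply/and4P; split=> //; [by apply/rooted_treeP; rewrite -Eb|exact/rooted_treeP|].
by rewrite /root_lbl /lbl /= ffunE (negPf (root_branch T jr)).
Qed.

Lemma glue_right_image : (a < b)%N -> glue_right @: right_dom
  = [set y in trees a b | (root_lbl y == c) && (y.1 == a :> nat)].
Proof.
move=> ab; apply/setP => -[r g]; rewrite !inE /=; apply/imsetP/idP.
  move=> [[i [[r' g1] [j g2]]]]; rewrite !inE /=.
  move=> /and3P[hi /and3P[/rooted_treeP T1 /eqP rc ra] /andP[/rooted_treeP T2 hc]].
  move=> [-> ->].
  have s := vseg_separated n a b i.
  have rV := rt_root T1.
  apply/and3P; split; [|by rewrite /root_lbl /= (attach_lbl_in _ _ _ _ s) // -rc|by []].
  apply/rooted_treeP; rewrite (vseg_join _ hi).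
  by apply: attach_rooted_tree => // _; rewrite -rc in hc.
move=> /and3P[/rooted_treeP T rc /eqP ra].
have [j [i [jr pj hi Eb]]] := exists_right_branch T bn ra ab.
have i_n : (i < n)%N by lia.
have sep : separated (vseg n a b :\: branch j g) (branch j g).
  by rewrite Eb vseg_split_high //; apply: vseg_separated.
have T1 := cut_branch_tree T jr pj sep; have T2 := cut_rest_tree T jr.
have EG := cut_attach pj.
exists (Ordinal i_n, ((r, cut_rest j g), (j, cut_branch j g))); last first.
  by rewrite /glue_right /= -Eb EG.
have jV := rt_root T1; rewrite Eb in_vseg in jV.
rewrite Eb vseg_split_high // in T2; rewrite !inE /= hi ra eqxx andbT.
rewrite /root_lbl /lbl /= !ffunE (negPf (root_branch T jr)).
rewrite mem_branch eqxx rc /=; apply/and3P; split.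
- by rewrite andbT; exact/rooted_treeP.
- by apply/rooted_treeP; rewrite -Eb.
- have := rt_label T (x := j); rewrite pj -(eqP rc) /root_lbl /=; apply; lia.
Qed.

(** Either the root is the left end, or the branch of its leftmost child, which fills an initial
    segment, can be cut off. *)
Lemma inner_sum_rec : inner_sum c a b = left_sum c a b
  + \sum_(i : vertex | (a <= i < b)%N)
      (\sum_(y in trees a i) weight a i y.2) * inner_sum c i.+1 b.
Proof.
rewrite /inner_sum (bigID (fun y : vertex * labelled => y.1 == a :> nat)) /=.
congr (_ + _).
  by apply: eq_bigl => y; rewrite andbA.
under [RHS]eq_bigr do rewrite big_distrlr /= pair_big /=.
rewrite pair_big_dep /=.
transitivity (\sum_(y in glue_left @: left_dom) weight a b y.2).
  apply: eq_bigl => y; rewrite glue_left_image !inE -andbA.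
  case: rooted_treeP => //= /rt_root; rewrite in_vseg; case: (_ == c) => //=; lia.
rewrite big_imset /=; last exact: glue_left_inj.
rewrite (eq_bigr left_weight); last exact: glue_left_weight.
by apply: eq_bigl => t; rewrite inE.
Qed.

Lemma left_sum_rec : (a < b)%N -> left_sum c a b
  = \sum_(i : vertex | (a <= i < b)%N) left_sum c a i
      * (\sum_(y in trees i.+1 b | (c + root_lbl y <= k.+1)%N)
           weight i.+1 b y.2).
Proof.
move=> ab; under [RHS]eq_bigr do rewrite big_distrlr /= pair_big /=.
rewrite pair_big_dep /=.
transitivity (\sum_(y in glue_right @: right_dom) weight a b y.2).
  by apply: eq_bigl => y; rewrite glue_right_image // !inE.
rewrite big_imset /=; last exact: glue_right_inj.
rewrite (eq_bigr left_weight); last exact: glue_right_weight.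
by apply: eq_bigl => t; rewrite inE.
Qed.

End Glue.

Lemma left_sum_single c a : (a < n)%N -> left_sum c a a = wt c.
Proof.
move=> an; pose v := Ordinal an.
pose g0 : labelled := [ffun x => if x == v then (v, c) else (x, ord0)].
have vE (x : vertex) : (x \in vseg n a a) = (x == v).
  by rewrite in_vseg -val_eqE /=; lia.
have pE x : par g0 x = x by rewrite /par ffunE; case: eqP => [->|].
rewrite /left_sum (big_pred1 (v, g0)) /weight => [|[r g]] /=.
  by rewrite (big_pred1 v) // /lbl ffunE eqxx.
apply/idP/eqP => [|[-> ->]].
  move=> /andP[/treesP /= T /andP[/eqP rc /eqP ra]].
  have -> : r = v by apply: val_inj.
  congr (_, _); apply/ffunP => x; rewrite ffunE; case: eqP => [->|/eqP xv].
    have := rt_closed T (x := v); rewrite !vE eqxx => /(_ isT) /eqP.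
    have rv : r = v by apply: val_inj.
    by move: rc; rewrite /root_lbl /par /lbl /= rv; case: (g v) => ? ? /= -> ->.
  by apply: (rt_outside T); rewrite vE.
rewrite /root_lbl /lbl /= ffunE eqxx /= !eqxx !andbT.
apply/treesP; split=> /=.
- by rewrite vE.
- by move=> x; rewrite pE.
- by move=> x; rewrite vE => /eqP ->; apply: connect0.
- by move=> x; rewrite vE ffunE => /negPf ->.
- by rewrite pE.
- by move=> x y; rewrite /lo /hi !pE; lia.
- by move=> x; rewrite /lo /hi !pE; lia.
- by move=> x; rewrite pE ltnn.
Qed.

Lemma tree_sum_split a b (P : pred 'I_k.+1) :
  \sum_(y in trees a b | P (root_lbl y)) weight a b y.2
  = \sum_(d | P d) inner_sum d a b.
Proof.
rewrite (partition_big (@root_lbl) P) => [|y /andP[]//].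
apply: eq_bigr => d Pd; apply: eq_bigl => y.
by case: eqP => [->|]; rewrite ?andbF // Pd andbT.
Qed.

Lemma inner_sumE c a b : (b < n)%N -> inner_sum c a b = left_sum c a b
  + \sum_(i : vertex | (a <= i < b)%N)
      (\sum_d inner_sum d a i) * inner_sum c i.+1 b.
Proof.
move=> bn; rewrite inner_sum_rec //; congr (_ + _); apply: eq_bigr => i _.
congr (_ * _); rewrite -(tree_sum_split a i predT).
by apply: eq_bigl => y; rewrite andbT.
Qed.

Lemma left_sumE c a b : (b < n)%N -> (a < b)%N -> left_sum c a b
  = \sum_(i : vertex | (a <= i < b)%N) left_sum c a i
      * (\sum_(d : 'I_k.+1 | (c + d <= k.+1)%N) inner_sum d i.+1 b).
Proof.
move=> bn ab; rewrite left_sum_rec //; apply: eq_bigr => i _.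
by congr (_ * _); rewrite -(tree_sum_split _ _ (fun d : 'I_k.+1 => c + d <= k.+1)%N).
Qed.

End WeightedCount.

(** * Power series up to a fixed degree *)

Section TruncatedSeries.
Variables (R : comNzRingType) (n : nat).
Implicit Types P Q : {poly R}.

Definition eqtr P Q : Prop := forall i, (i <= n)%N -> P`_i = Q`_i.

Lemma eqtr_refl P : eqtr P P. Proof. by []. Qed.

Lemma eqtr_sym P Q : eqtr P Q -> eqtr Q P.
Proof. by move=> H i hi; rewrite H. Qed.

Lemma eqtr_trans P Q S : eqtr P Q -> eqtr Q S -> eqtr P S.
Proof. by move=> H1 H2 i hi; rewrite H1 ?H2. Qed.

Lemma eqtrM P P' Q Q' : eqtr P P' -> eqtr Q Q' -> eqtr (P * Q) (P' * Q').
Proof.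
move=> HP HQ i hi; rewrite !coefM; apply: eq_bigr => j _.
by rewrite HP ?HQ //; have := ltn_ord j; lia.
Qed.

(** Stands in for 1 / (1 - P). *)
Definition geom P : {poly R} := \sum_(i < n.+1) P ^+ i.

Lemma geom_inv P : P`_0 = 0 -> eqtr ((1 - P) * geom P) 1.
Proof.
move=> P0; have -> : (1 - P) * geom P = 1 - P ^+ n.+1.
  by rewrite -opprB mulNr -subrX1 opprB.
have /factor_theorem[P' ->] : root P 0 by rewrite rootE horner_coef0 P0.
by move=> i hi; rewrite subr0 exprMn coefB coefMXn ltnS hi subr0.
Qed.

End TruncatedSeries.

(** * Functional equations of the generating functions *)

Section TreeSeries.
Variables (n k : nat) (R : comNzRingType) (wt : 'I_k.+1 -> R).
Hypothesis wt0 : wt ord0 = 0.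

(** The interval from [a] to [a + m] has [m + 1] vertices; hence the shift of the index in the
    series below. *)
Let inner c a m : R := @inner_sum n k R wt c a (a + m).
Let left c a m : R := @left_sum n k R wt c a (a + m).

Lemma sum_vseg (F : nat -> R) a m : (a + m <= n)%N ->
  \sum_(i : 'I_n | (a <= i < a + m)%N) F i = \sum_(s < m) F (a + s)%N.
Proof.
move=> h; rewrite -(big_mkord (fun i => a <= i < a + m)%N F).
rewrite -[in RHS](big_mkord xpredT (fun s => F (a + s)%N)).
have -> : \sum_(0 <= s < m) F (a + s)%N = \sum_(a <= i < a + m) F i.
  rewrite -{2}[a]add0n big_addn addKn.
  by apply: eq_bigr => i _; rewrite addnC.
rewrite (big_nat_widen a (a + m) n) // (big_nat_widenl a 0) //.
by apply: eq_bigl => i; rewrite andbC.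
Qed.

Lemma inner_rec c a m : (a + m < n)%N -> inner c a m = left c a m
  + \sum_(s < m) (\sum_d inner d a s) * inner c (a + s).+1 (m - s.+1).
Proof.
move=> h; rewrite /inner inner_sumE //; congr (_ + _).
rewrite (sum_vseg (fun i => (\sum_d inner_sum n wt d a i)
   * inner_sum n wt c i.+1 (a + m))); last by lia.
apply: eq_bigr => s _; congr (_ * inner_sum _ _ _ _ _).
by have := ltn_ord s; lia.
Qed.

Lemma left_rec c a m : (a + m < n)%N -> (0 < m)%N -> left c a m
  = \sum_(s < m) left c a s *
      \sum_(d : 'I_k.+1 | (c + d <= k.+1)%N) inner d (a + s).+1 (m - s.+1).
Proof.
move=> h m0; rewrite /left left_sumE //; last by lia.
rewrite (sum_vseg (fun i => left_sum n wt c a i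
  * \sum_(d : 'I_k.+1 | (c + d <= k.+1)%N) inner_sum n wt d i.+1 (a + m))); last by lia.
apply: eq_bigr => s _; congr (_ * _); apply: eq_bigr => d _.
by rewrite /inner; congr (inner_sum _ _ _ _ _); have := ltn_ord s; lia.
Qed.

(** Translation invariance: both recurrences see only the length of the interval. Intervals that
    start at 0 can therefore supply the coefficients. *)
Lemma sum_shift m : forall c a, (a + m < n)%N ->
  left c a m = left c 0 m /\ inner c a m = inner c 0 m.
Proof.
elim: {m}m.+1 {-2}m (ltnSn m) => // M IH m mM c a h.
have E : left c a m = left c 0 m.
  case: m mM h => [|m] mM h.
    by rewrite /left !addn0 !left_sum_single //; lia.
  rewrite !left_rec //; last by lia.
  apply: eq_bigr => s _; have sm := ltn_ord s; congr (_ * _).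
    by apply: (proj1 (IH s _ c a _)); lia.
  apply: eq_bigr => d _.
  rewrite (proj2 (IH _ _ d (a + s).+1 _)); try lia.
  by rewrite (proj2 (IH _ _ d (0 + s).+1 _)) //; lia.
split=> //; rewrite !inner_rec //; last by lia.
rewrite E; congr (_ + _); apply: eq_bigr => s _; have sm := ltn_ord s.
congr (_ * _).
  by apply: eq_bigr => d _; rewrite (proj2 (IH _ _ d a _)) //; lia.
rewrite (proj2 (IH _ _ c (a + s).+1 _)); try lia.
by rewrite (proj2 (IH _ _ c (0 + s).+1 _)) //; lia.
Qed.

Lemma inner0 a m : inner ord0 a m = 0.
Proof.
rewrite /inner /inner_sum big1 // => -[r g] /andP[/treesP /= T /eqP r0].
rewrite /weight (bigD1 r) ?(rt_root T) //=.
by rewrite -/(root_lbl (r, g)) r0 wt0 mul0r.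
Qed.

(** B_c up to degree [n], the polynomial variable marking the number of vertices; likewise [leftS]
    for N_c. *)
Definition innerS c : {poly R} :=
  \poly_(i < n.+1) (if i is m.+1 then inner c 0 m else 0).

Definition leftS c : {poly R} :=
  \poly_(i < n.+1) (if i is m.+1 then left c 0 m else 0).

(** This is B_1 + ... + B_j: the term of label 0 is zero because its weight is. *)
Definition partialS (j : nat) : {poly R} :=
  \sum_(d : 'I_k.+1 | (d <= j)%N) innerS d.

Lemma coef_innerS c m : (m < n)%N -> (innerS c)`_m.+1 = inner c 0 m.
Proof. by move=> h; rewrite coef_poly ltnS h. Qed.

Lemma coef_leftS c m : (m < n)%N -> (leftS c)`_m.+1 = left c 0 m.
Proof. by move=> h; rewrite coef_poly ltnS h. Qed.

Lemma coef0_innerS c : (innerS c)`_0 = 0. Proof. by rewrite coef_poly. Qed.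
Lemma coef0_leftS c : (leftS c)`_0 = 0. Proof. by rewrite coef_poly. Qed.

Lemma coef0_partialS j : (partialS j)`_0 = 0.
Proof. by rewrite coef_sum big1 // => d _; apply: coef0_innerS. Qed.

Lemma coefMS (P Q : {poly R}) m : P`_0 = 0 -> Q`_0 = 0 ->
  (P * Q)`_m.+1 = \sum_(s < m) P`_s.+1 * Q`_(m - s.+1).+1.
Proof.
move=> P0 Q0; rewrite coefM big_ord_recl P0 mul0r add0r big_ord_recr /=.
rewrite /bump /= add1n subnn Q0 mulr0 addr0; apply: eq_bigr => s _.
by rewrite add1n; congr (_ * _`_ _); have := ltn_ord s; lia.
Qed.

Lemma innerS_eq c : eqtr n (innerS c * (1 - partialS k)) (leftS c).
Proof.
have -> : innerS c * (1 - partialS k) = innerS c - partialS k * innerS c.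
  by rewrite mulrBr mulr1 mulrC.
move=> [|m] hm; rewrite coefB.
  by rewrite coef0M coef0_innerS coef0_leftS mulr0 subr0.
rewrite coef_innerS // coef_leftS // coefMS ?coef0_innerS ?coef0_partialS //.
apply/eqP; rewrite subr_eq inner_rec //; apply/eqP; congr (_ + _).
apply: eq_bigr => s _; have sm := ltn_ord s.
rewrite coef_innerS; last by lia.
rewrite (proj2 (sum_shift c (a := (0 + s).+1) _)); last by lia.
congr (_ * _); rewrite coef_sum; apply: eq_big => [d|d _].
  by rewrite -ltnS ltn_ord.
by rewrite coef_innerS //; lia.
Qed.

Lemma leftS_eq c :
  eqtr n (leftS c * (1 - partialS (k.+1 - c))) ('X * (wt c)%:P).
Proof.
have -> : leftS c * (1 - partialS (k.+1 - c))
  = leftS c - leftS c * partialS (k.+1 - c) by rewrite mulrBr mulr1.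
move=> [|m] hm; rewrite coefB coefXM /=.
  by rewrite coef0M coef0_leftS mul0r subr0.
rewrite coef_leftS // coefMS ?coef0_leftS ?coef0_partialS // coefC.
case: m hm => [|m] hm; first by rewrite big_ord0 subr0 /left left_sum_single.
apply/eqP; rewrite subr_eq add0r left_rec //; apply/eqP.
apply: eq_bigr => s _; have sm := ltn_ord s.
rewrite coef_leftS; last by lia.
congr (_ * _); rewrite coef_sum; apply: eq_big => [d|d _].
  by have := ltn_ord c; lia.
rewrite coef_innerS; last by lia.
by rewrite (proj2 (sum_shift d (a := (0 + s).+1) _)) //; lia.
Qed.

Definition Useries j : {poly R} := 1 - partialS j.
Definition Qseries j : {poly R} := geom n (partialS j).

Lemma innerS_ord0 : innerS ord0 = 0.
Proof.
by apply/polyP => -[|i]; rewrite coef_poly coef0 ?if_same // inner0 if_same.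
Qed.

Lemma partialS0 : partialS 0 = 0.
Proof.
rewrite /partialS (big_pred1 ord0) ?innerS_ord0 // => d.
by rewrite /= -val_eqE leqn0.
Qed.

Lemma Useries0 : Useries 0 = 1.
Proof. by rewrite /Useries partialS0 subr0. Qed.

Lemma Qseries0 : Qseries 0 = 1.
Proof.
rewrite /Qseries partialS0 /geom big_ord_recl expr0 big1 ?addr0 // => i _.
by rewrite expr0n.
Qed.

Lemma Useries_inv j : eqtr n (Useries j * Qseries j) 1.
Proof. by apply: geom_inv; apply: coef0_partialS. Qed.

Lemma Useries_step (c : 'I_k.+1) : (0 < c)%N ->
  Useries c.-1 - Useries c = innerS c.
Proof.
move=> c0; rewrite /Useries opprB addrC addrA subrK.
rewrite /partialS (bigD1 c) //= -addrA [X in _ + X](_ : _ = 0) ?addr0 //.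
apply/eqP; rewrite subr_eq0; apply/eqP; apply: eq_bigl => d.
by rewrite -val_eqE /=; lia.
Qed.

Lemma leftS_Q c :
  eqtr n (leftS c) ('X * (wt c)%:P * Qseries (k.+1 - c)).
Proof.
refine (eqtr_trans _ (eqtrM (leftS_eq c) (@eqtr_refl R n (Qseries (k.+1 - c))))).
rewrite -mulrA -[X in eqtr _ X]mulr1; apply: eqtrM => //.
exact: eqtr_sym (Useries_inv _).
Qed.

Lemma innerS_Q c :
  eqtr n (innerS c) ('X * (wt c)%:P * Qseries k * Qseries (k.+1 - c)).
Proof.
rewrite mulrAC; refine (eqtr_trans _ (eqtrM (leftS_Q c) (@eqtr_refl R n (Qseries k)))).
refine (eqtr_trans _ (eqtrM (innerS_eq c) (@eqtr_refl R n (Qseries k)))).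
rewrite -mulrA -[X in eqtr _ X]mulr1; apply: eqtrM => //.
exact: eqtr_sym (Useries_inv _).
Qed.

End TreeSeries.

(** * The closed form *)

Lemma binq0 (a : int) : binq a 0 = 1.
Proof. by rewrite /binq big_ord0 fact0 divr1. Qed.

Lemma fact_neq0 (b : nat) : (b`!)%:R != 0 :> rat.
Proof. by rewrite pnatr_eq0 -lt0n fact_gt0. Qed.

Lemma binqS (a : int) (b : nat) :
  b.+1%:R * binq a b.+1 = (a - b%:Z)%:~R * binq a b.
Proof.
rewrite /binq big_ord_recr /= factS natrM.
have := fact_neq0 b; have : b.+1%:R != 0 :> rat by rewrite pnatr_eq0.
by move=> h1 h2; field; rewrite nat1r h1 h2.
Qed.

Lemma binqSl (a : int) (b : nat) :
  b.+1%:R * binq a b.+1 = a%:~R * binq (a - 1) b.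
Proof.
rewrite /binq big_ord_recl /= subr0 factS natrM.
have -> : \prod_(i < b) (a - (bump 0 i)%:Z)%:~R
        = \prod_(i < b) (a - 1 - i%:Z)%:~R :> rat.
  by apply: eq_bigr => i _; congr (_ %:~R); rewrite /bump; lia.
have := fact_neq0 b; have : b.+1%:R != 0 :> rat by rewrite pnatr_eq0.
by move=> h1 h2; field; rewrite nat1r h1 h2.
Qed.

Lemma binq_absorb (a : int) (b : nat) :
  a%:~R * binq (a - 1) b = (a - b%:Z)%:~R * binq a b.
Proof. by rewrite -binqSl binqS. Qed.

Lemma binq_pascal (a : int) (b : nat) :
  binq (a + 1) b.+1 = binq a b.+1 + binq a b.
Proof.
have hb : b.+1%:R != 0 :> rat by rewrite pnatr_eq0.
apply: (mulfI hb); rewrite mulrDr binqSl binqS addrK.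
by rewrite -mulrDl -[b.+1%:R]/(b.+1%:~R) -intrD; congr (_ %:~R * _); lia.
Qed.

(** Upper negation; it will absorb the signs of [sigcoef] at odd positions. *)
Lemma binq_neg (a : int) (b : nat) :
  (-1) ^+ b * binq (- a) b = binq (a + b%:Z - 1) b.
Proof.
elim: b a => [|b IH] a; first by rewrite !binq0 expr0 mul1r.
have hb : b.+1%:R != 0 :> rat by rewrite pnatr_eq0.
apply: (mulfI hb); rewrite mulrCA binqSl binqS.
rewrite exprS -!mulrA [_ ^+ b * _]mulrCA -opprD IH mulN1r intrN mulNr opprK.
by congr (_ %:~R * binq _ _); lia.
Qed.

(** * Coefficients of products of the factors 1 - sigma_i *)

Section Chain.
Variable k : nat.

Implicit Types (L : nat -> nat) (e : nat -> int).

(* The exponent of 1 - sigma_i once the coefficients of the variables at the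
   positions above i have been extracted. *)
Definition slope L e (i : nat) : int :=
  \sum_(i <= j < k.+1) e j - (\sum_(i.+1 <= j < k.+1) L j)%:Z.

(* The coefficient of y^L in prod_i (1 - sigma_i)^(e i), where
   sigma_i = y_1 - y_2 + ... + (-1)^(i-1) y_i. *)
Definition sigcoef L e : rat :=
  \prod_(1 <= i < k.+1) ((-1) ^+ (odd i * L i) * binq (slope L e i) (L i)).

(** For [i = 0] it vanishes at all positions 1 to k, in agreement with 1 - sigma_0 = 1. *)
Definition unitv (i : nat) : nat -> int := fun j => (j == i)%:R.

Definition decr (i : nat) L : nat -> nat := fun j => (L j - (j == i))%N.

Lemma eq_slope L e e' i : (0 < i)%N ->
    (forall j, (0 < j <= k)%N -> e j = e' j) -> slope L e i = slope L e' i.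
Proof.
move=> i0 H; rewrite /slope; congr (_ - _).
by apply: eq_big_nat => j /andP[h1 h2]; apply: H; lia.
Qed.

Lemma eq_sigcoef L e e' :
  (forall j, (0 < j <= k)%N -> e j = e' j) -> sigcoef L e = sigcoef L e'.
Proof.
move=> H; apply: eq_big_nat => i hi.
by congr (_ * binq _ _); apply: eq_slope => //; case/andP: hi.
Qed.

Lemma sum_unitv (i m : nat) : (i <= k)%N ->
  \sum_(m <= j < k.+1) unitv i j = (m <= i)%:R :> int.
Proof.
move=> ik; rewrite /unitv; have [mi|im] := leqP m i.
  rewrite (big_cat_nat mi) /=; last by lia.
  rewrite big_nat big1 ?add0r; last by move=> j hj; rewrite ltn_eqF; lia.
  rewrite big_nat_recl //= eqxx big_nat big1 ?addr0 // => j hj.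
  by rewrite gtn_eqF; lia.
by rewrite big_nat big1 // => j hj; rewrite gtn_eqF; lia.
Qed.

Lemma slope_add L e f i :
  slope L (fun j => e j + f j) i = slope L e i + \sum_(i <= j < k.+1) f j.
Proof. by rewrite /slope big_split /= addrAC. Qed.

Lemma slope_addu L e i m : (i <= k)%N ->
  slope L (fun j => e j + unitv i j) m = slope L e m + (m <= i)%:R.
Proof. by move=> ik; rewrite slope_add sum_unitv. Qed.

Lemma slope_subu L e i m : (i <= k)%N ->
  slope L (fun j => e j - unitv i j) m = slope L e m - (m <= i)%:R.
Proof. by move=> ik; rewrite slope_add sumrN sum_unitv. Qed.

Lemma sum_decr L i m : (i <= k)%N -> (0 < L i)%N ->
  (\sum_(m <= j < k.+1) decr i L j = \sum_(m <= j < k.+1) L j - (m <= i))%N.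
Proof.
move=> ik Li.
suff: (\sum_(m <= j < k.+1) L j
        = \sum_(m <= j < k.+1) decr i L j + (m <= i))%N by lia.
have := sum_unitv m ik; rewrite /unitv.
have -> : \sum_(m <= j < k.+1) (j == i)%:R
        = (\sum_(m <= j < k.+1) (j == i))%N%:Z :> int.
  by rewrite -natz natr_sum.
rewrite natz => -[<-]; rewrite -big_split /=; apply: eq_bigr => j _.
by rewrite /decr; case: eqP => [->|_]; lia.
Qed.

Lemma slope_decr L e i m : (i <= k)%N -> (0 < L i)%N ->
  slope (decr i L) e m = slope L e m + (m < i)%:R.
Proof.
move=> ik Li; rewrite /slope sum_decr //.
suff : ((m < i)%N <= \sum_(m.+1 <= j < k.+1) L j)%N.
  by move=> hs; rewrite -subzn // natz opprB addrA addrAC.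
case: (ltnP m i) => //= mi.
rewrite (big_cat_nat mi) /=; last by lia.
by rewrite [X in (_ + X)%N]big_ltn ?ltnS //; move: Li; lia.
Qed.

(** Coefficient form of (1 - sigma_(i-1)) - (1 - sigma_i) = (-1)^(i-1) y_i. The slopes of the two
    products differ at position [i] only, and there Pascal's rule applies. *)
Lemma sigcoef_pascal L e i : (0 < i <= k)%N ->
  sigcoef L (fun j => e j + unitv i.-1 j) - sigcoef L (fun j => e j + unitv i j)
  = if L i == 0%N then 0 else (-1) ^+ i.-1 * sigcoef (decr i L) e.
Proof.
move=> /andP[i0 ik]; have ik1 : (i.-1 <= k)%N by lia.
have split3 (F : nat -> rat) : \prod_(1 <= j < k.+1) F j
    = \prod_(1 <= j < i) F j * F i * \prod_(i.+1 <= j < k.+1) F j.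
  rewrite (@big_cat_nat _ _ _ i) //=; last by lia.
  by rewrite [X in _ * X]big_ltn // mulrA.
rewrite /sigcoef !split3.
set P1 := \prod_(1 <= j < i) _; set P2 := \prod_(i.+1 <= j < k.+1) _.
set P3 := \prod_(1 <= j < i) _; set P4 := \prod_(i.+1 <= j < k.+1) _.
set P5 := \prod_(1 <= j < i) _; set P6 := \prod_(i.+1 <= j < k.+1) _.
have E3 : P1 = P3.
  apply: eq_big_nat => j /andP[j0 ji]; rewrite !slope_addu //.
  by have -> : (j <= i.-1)%N = (j <= i)%N by lia.
have E4 : P2 = P4.
  apply: eq_big_nat => j /andP[j0 ji]; rewrite !slope_addu //.
  by have -> : (j <= i.-1)%N = (j <= i)%N by lia.
rewrite !slope_addu // leqnn -E3 -E4.
have -> : (i <= i.-1)%N = false by lia.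
rewrite addr0; case Li : (L i) => [|c] /=.
  by rewrite !binq0 subrr.
have Li0 : (0 < L i)%N by rewrite Li.
have E5 : P5 = P1.
  apply: eq_big_nat => j /andP[j0 ji]; rewrite slope_addu // slope_decr //.
  have -> : (j <= i.-1)%N = (j < i)%N by lia.
  have -> : decr i L j = L j by rewrite /decr; lia.
  by [].
have E6 : P6 = P2.
  apply: eq_big_nat => j /andP[j0 ji]; rewrite slope_addu // slope_decr //.
  have -> : (j <= i.-1)%N = (j < i)%N by lia.
  have -> : decr i L j = L j by rewrite /decr; lia.
  by [].
rewrite E5 E6 slope_decr // ltnn addr0 {2}/decr eqxx Li subn1 /= binq_pascal.
rewrite /decr eqxx Li subn1 /=.
have -> : odd i = ~~ odd i.-1 by rewrite -{1}(prednK i0).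
rewrite -(signr_odd _ i.-1); case: (odd i.-1) => /=.
  by rewrite !mul0n !expr0 expr1; ring.
by rewrite !mul1n exprS !expr0; ring.
Qed.

(* Euler's relation for the factors 1 - sigma_i with i >= j, in terms of
   coefficients. *)
Lemma sigcoef_euler L e j : (j <= k)%N ->
  \sum_(j <= i < k.+1) (e i)%:~R * sigcoef L (fun m => e m - unitv i m)
  = (slope L e j)%:~R * sigcoef L (fun m => e m - unitv j m).
Proof.
move=> jk.
elim: {j}(k - j)%N {-2}j (erefl (k - j)%N) jk => [|d IH] j Ed jk.
  have -> : j = k by lia.
  rewrite big_nat1 /slope big_nat1 [X in _ - X%:Z]big_geq //.
  by rewrite subr0.
have jk1 : (j.+1 <= k)%N by lia.
rewrite big_ltn // IH //; last by lia.
suff -> : (slope L e j.+1)%:~R * sigcoef L (fun m => e m - unitv j.+1 m)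
     = (slope L e j - e j)%:~R * sigcoef L (fun m => e m - unitv j m).
  by rewrite intrB; ring.
rewrite /sigcoef !(@big_cat_nat _ _ _ j.+1 1 k.+1) //=; try lia.
rewrite ![\prod_(j.+1 <= i < k.+1) _]big_ltn //; try lia.
rewrite !slope_subu // leqnn ltnn subr0.
set P1 := \prod_(1 <= i < j.+1) _; set P2 := \prod_(j.+2 <= i < k.+1) _.
set P3 := \prod_(1 <= i < j.+1) _; set P4 := \prod_(j.+2 <= i < k.+1) _.
have -> : P1 = P3.
  apply: eq_big_nat => m /andP[m0 mj]; rewrite !slope_subu //; try lia.
  by have -> : (m <= j.+1)%N = (m <= j)%N by lia.
have -> : P2 = P4.
  apply: eq_big_nat => m /andP[m0 mj]; rewrite !slope_subu //; try lia.
  by have -> : (m <= j.+1)%N = (m <= j)%N by lia.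
have -> : slope L e j - e j = slope L e j.+1 - (L j.+1)%:Z.
  rewrite /slope (big_ltn (m := j) (n := k.+1)) //.
  by rewrite [(\sum_(j.+1 <= i < k.+1) L i)%N]big_ltn // PoszD; ring.
have H : (slope L e j.+1)%:~R * binq (slope L e j.+1 - true%:R) (L j.+1)
    = (slope L e j.+1 - (L j.+1)%:Z)%:~R * binq (slope L e j.+1) (L j.+1).
  exact: binq_absorb.
transitivity (P3 * (-1) ^+ (odd j.+1 * L j.+1) * P4
  * ((slope L e j.+1)%:~R * binq (slope L e j.+1 - true%:R) (L j.+1))).
  by rewrite !mulrA; ring.
by rewrite H; ring.
Qed.

End Chain.

(** * The closed form and its recurrence *)

Section ClosedForm.
Variable k : nat.

Implicit Types (L l : nat -> nat) (e c : nat -> int).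

Lemma eq_sigcoef_content L L' e :
  (forall j, (0 < j <= k)%N -> L j = L' j) -> sigcoef k L e = sigcoef k L' e.
Proof.
move=> H; apply: eq_big_nat => i hi; rewrite H //.
congr (_ * binq _ _); rewrite /slope; congr (_ - Posz _).
by apply: eq_big_nat => j /andP[h1 h2]; apply: H; lia.
Qed.

(* The exponents of u = u_k in the factors 1 - sigma_i. *)
Definition dvec (i : nat) : int := (-1) ^+ i.+1 * (2 - (i == k)%:R).

(* The exponents of the i-th term of the sequence
   u_0, u_k, u_1, u_(k-1), u_2, ... *)
Definition svec (i : nat) : nat -> int :=
  fun j => (odd i)%:R * dvec j + (if (j < i)%N then (-1) ^+ (i + j).+1 else 0).

(** The exponents of U_j: low indices sit at the even places of the zigzag, high ones at the odd
    places. *)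
Definition uvec (j : nat) : nat -> int :=
  if (j.*2 <= k)%N then svec j.*2 else svec (k - j).*2.+1.

Definition csize L : nat := (\sum_(1 <= j < k.+1) L j)%N.

(** Includes the Jacobian of Lagrange's formula. As all x_i are y_i u^2, it is 1 + 2 E(log u) with
    the Euler operator E = sum_i y_i d/dy_i; here log u is the sum of the d_i log(1 - sigma_i),
    where d is [dvec], and E(log(1 - sigma_i)) = 1 - 1 / (1 - sigma_i). *)
Definition coefPsi L e : rat :=
  sigcoef k L e + 2 * \sum_(1 <= i < k.+1)
    (dvec i)%:~R * (sigcoef k L e - sigcoef k L (fun j => e j - unitv i j)).

(* The coefficient of x^L in prod_i (1 - sigma_i)^(c i) by Lagrange inversion,
   where x_i = y_i u^2. *)
Definition coefx L c : rat :=
  coefPsi L (fun j => c j - (csize L).*2%:Z * dvec j).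

Lemma eq_coefPsi L L' e e' :
    (forall j, (0 < j <= k)%N -> L j = L' j) ->
    (forall j, (0 < j <= k)%N -> e j = e' j) ->
  coefPsi L e = coefPsi L' e'.
Proof.
move=> HL He; rewrite /coefPsi -(eq_sigcoef_content _ HL) (eq_sigcoef _ He).
congr (_ + _ * _); apply: eq_bigr => i _; congr (_ * (_ - _)).
rewrite -(eq_sigcoef_content _ HL); apply: eq_sigcoef => j hj.
by rewrite He.
Qed.

Lemma eq_coefx L L' c c' :
    (forall j, (0 < j <= k)%N -> L j = L' j) ->
    (forall j, (0 < j <= k)%N -> c j = c' j) ->
  coefx L c = coefx L' c'.
Proof.
move=> HL Hc; apply: eq_coefPsi => // j hj; rewrite Hc //.
suff -> : csize L = csize L' by [].
by apply: eq_big_nat => i hi; apply: HL; lia.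
Qed.

(** Places k and k+1 of the zigzag hold the same U_j, that of the middle. The exceptional last entry
    of [dvec] is chosen for this. *)
Lemma svec_close j : (0 < j <= k)%N -> svec k j = svec k.+1 j.
Proof.
move=> /andP[j0 jk]; rewrite /svec /dvec ltnS jk /= addSn !exprS.
rewrite exprD -(signr_odd _ k) -(signr_odd _ j) ltn_neqAle jk andbT.
by case: eqP => [->|_]; case: (odd k); case: (odd j) => //=; ring.
Qed.

(** Multiplicatively s_(i-1) s_i = u (1 - sigma_(i-1)), where s_i has the exponents [svec i]. *)
Lemma svec_sum i j : (0 < i)%N -> (0 < j)%N ->
  svec i.-1 j + svec i j = dvec j + unitv i.-1 j.
Proof.
case: i => // i _ j0; rewrite /svec /unitv ltnS (leq_eqVlt j i) /= addSn.
case: eqP => [->|] /=; first rewrite ltnn [in X in _ + X]exprS.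
  rewrite -signr_odd /= oddD addbb expr1.
  by case: (odd i) => /=; ring.
by move=> _; rewrite [in X in _ + X]exprS; case: ifP => _; case: (odd i) => /=; ring.
Qed.

Lemma csize_decr L i : (0 < i <= k)%N -> (0 < L i)%N ->
  csize L = (csize (decr i L)).+1.
Proof.
move=> /andP[i0 ik] Li; rewrite /csize sum_decr // i0 subn1 prednK //.
by rewrite (@big_cat_nat _ _ _ i) //=; [rewrite [X in (_ + X)%N]big_ltn; lia|lia].
Qed.

(** [coefPsi] combines values of [sigcoef] at shifted exponents with coefficients that depend on
    neither [L] nor [e], so it inherits the recurrence. *)
Lemma coefPsi_pascal L e i : (0 < i <= k)%N ->
  coefPsi L (fun j => e j + unitv i.-1 j)
    - coefPsi L (fun j => e j + unitv i j)
  = if L i == 0%N then 0 else (-1) ^+ i.-1 * coefPsi (decr i L) e.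
Proof.
move=> hi; rewrite /coefPsi.
have P := sigcoef_pascal L e hi.
have Pm m : sigcoef k L (fun j => e j + unitv i.-1 j - unitv m j)
    - sigcoef k L (fun j => e j + unitv i j - unitv m j)
  = if L i == 0%N then 0 else
    (-1) ^+ i.-1 * sigcoef k (decr i L) (fun j => e j - unitv m j).
  rewrite -sigcoef_pascal //; congr (_ - _); apply: eq_sigcoef => j _;
  by rewrite addrAC.
rewrite opprD addrACA P -mulrBr -sumrB.
have E : \sum_(1 <= m < k.+1) ((dvec m)%:~R
    * (sigcoef k L (fun j => e j + unitv i.-1 j)
       - sigcoef k L (fun j => e j + unitv i.-1 j - unitv m j))
    - (dvec m)%:~R * (sigcoef k L (fun j => e j + unitv i j)
       - sigcoef k L (fun j => e j + unitv i j - unitv m j)))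
  = \sum_(1 <= m < k.+1) (dvec m)%:~R * (if L i == 0%N then 0 else
      (-1) ^+ i.-1 * (sigcoef k (decr i L) e
         - sigcoef k (decr i L) (fun j => e j - unitv m j))) :> rat.
  apply: eq_bigr => m _; rewrite -mulrBr; congr (_ * _).
  rewrite opprD addrACA -opprD P Pm.
  by case: eqP => _; rewrite ?subrr ?mulrBr.
rewrite E; case: eqP => _.
  by rewrite big1 ?mulr0 ?addr0 // => m _; rewrite mulr0.
rewrite mulrDr; congr (_ + _); rewrite mulrCA; congr (_ * _).
by rewrite mulr_sumr; apply: eq_bigr => m _; rewrite mulrCA.
Qed.

(** Dividing the neighbour products by s_i gives s_(i-1) - s_(i+1) = (-1)^(i-1) y_i u / s_i, and y_i
    u = x_i / u. The passage from y_i to x_i matches the drop of [csize] by one in the exponent of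
    u. *)
Lemma coefx_rec L c i : (0 < i <= k)%N ->
  coefx L (fun j => c j + svec i.-1 j) - coefx L (fun j => c j + svec i.+1 j)
  = if L i == 0%N then 0
    else (-1) ^+ i.-1 * coefx (decr i L) (fun j => c j - dvec j - svec i j).
Proof.
move=> hi; have /andP[i0 ik] := hi.
pose e j := c j - svec i j + dvec j - (csize L).*2%:Z * dvec j.
transitivity (coefPsi L (fun j => e j + unitv i.-1 j)
    - coefPsi L (fun j => e j + unitv i j)).
  congr (_ - _); apply: eq_coefPsi => // j /andP[j0 _].
    have := svec_sum i0 j0; move: (svec i.-1 j) => s /(canRL (addrK _)) ->.
    by rewrite /e; ring.
  have := @svec_sum i.+1 j isT j0; rewrite [i.+1.-1]/=.
  by move=> /(canRL (addKr _)) ->; rewrite /e; ring.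
rewrite coefPsi_pascal //; case: eqP => // Li; congr (_ * _).
apply: eq_coefPsi => // j _; rewrite /e (@csize_decr L i) //; last by lia.
by rewrite doubleS -addn2 PoszD; ring.
Qed.

(** The positions 1, 2, 3, 4, ... belong to the labels 1, k, 2, k-1, ...; [lpos] is the inverse. *)
Definition lab (i : nat) : nat := if odd i then uphalf i else (k.+1 - i./2)%N.

Definition lpos (j : nat) : nat :=
  if (j.*2 <= k.+1)%N then j.*2.-1 else (k.+1 - j).*2.

Lemma lpos_bound j : (0 < j <= k)%N -> (0 < lpos j <= k)%N.
Proof. by rewrite /lpos; case: ifP; lia. Qed.

Lemma lposK j : (0 < j <= k)%N -> lab (lpos j) = j.
Proof.
rewrite /lpos /lab => hj; case: leqP => h.
  have -> : (j.*2.-1)%N = (j.-1).*2.+1 by lia.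
  by rewrite /= odd_double /= doubleK; lia.
by rewrite odd_double doubleK; lia.
Qed.

Lemma lab_bound i : (0 < i <= k)%N -> (0 < lab i <= k)%N.
Proof.
move=> hi; rewrite /lab; have := odd_double_half i; rewrite uphalf_half.
by case: (odd i); lia.
Qed.

Lemma labK i : (0 < i <= k)%N -> lpos (lab i) = i.
Proof.
move=> hi; rewrite /lab; have := odd_double_half i; rewrite uphalf_half /lpos.
by case: (odd i); case: ifP; lia.
Qed.

Lemma uvec_even j i : (j.*2 <= k.+1)%N -> (0 < i <= k)%N ->
  uvec j i = svec j.*2 i.
Proof.
move=> hj hi; rewrite /uvec; case: leqP => // h.
have E : j.*2 = k.+1 by lia.
have -> : (k - j).*2.+1 = k by lia.
by rewrite E svec_close.
Qed.

Lemma uvec_odd j i : (j <= k)%N -> (k <= j.*2)%N -> (0 < i <= k)%N ->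
  uvec j i = svec (k - j).*2.+1 i.
Proof.
move=> jk hj hi; rewrite /uvec; case: leqP => // h.
have E : j.*2 = k by lia.
have -> : (k - j).*2.+1 = k.+1 by lia.
by rewrite E svec_close.
Qed.

Lemma uvec0 i : (0 < i)%N -> uvec 0 i = 0.
Proof. by move=> hi; rewrite /uvec /= /svec /= mul0r add0r. Qed.

Lemma uveck i : (0 < i <= k)%N -> uvec k i = dvec i.
Proof.
move=> hi; rewrite uvec_odd //; [|lia]; rewrite subnn /svec /= mul1r.
have -> : (i < 1)%N = false by lia.
by rewrite addr0.
Qed.

Definition labcoef l c : rat := coefx (fun i => l (lab i)) c.

(** Coefficient form of (U_(j-1) - U_j) U_k U_(k+1-j) = x_j. At even positions the zigzag meets U_j
    before U_(j-1), which cancels the sign of [coefx_rec]. *)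
Lemma labcoef_rec l c j : (0 < j <= k)%N ->
  labcoef l (fun i => c i + uvec j.-1 i) - labcoef l (fun i => c i + uvec j i)
  = if l j == 0%N then 0
    else labcoef (decr j l) (fun i => c i - uvec k i - uvec (k.+1 - j)%N i).
Proof.
move=> hj; have hp := lpos_bound hj.
have E := coefx_rec (fun i => l (lab i)) c hp; rewrite lposK // in E.
have Ed : forall i, (0 < i <= k)%N ->
    decr (lpos j) (fun i => l (lab i)) i = decr j l (lab i).
  move=> i hi; rewrite /decr; congr (_ - nat_of_bool _)%N.
  by apply/eqP/eqP => [->|<-]; rewrite ?lposK ?labK.
have Er : coefx (decr (lpos j) (fun i => l (lab i)))
      (fun i => c i - dvec i - svec (lpos j) i)
    = labcoef (decr j l) (fun i => c i - uvec k i - uvec (k.+1 - j)%N i).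
  apply: eq_coefx => // i hi; rewrite uveck // /lpos; congr (_ - _ - _).
  case: leqP => h; last by rewrite uvec_even //; lia.
  by rewrite uvec_odd //; [congr (svec _ _)|..]; lia.
rewrite {}Er in E; move: E; rewrite /lpos; case: leqP => h.
  have -> : j.*2.-1.-1 = (j.-1).*2 by lia.
  have -> : j.*2.-1.+1 = j.*2 by lia.
  rewrite -signr_odd odd_double expr0 mul1r => <-.
  by congr (_ - _); apply: eq_coefx => // i hi; rewrite uvec_even //; lia.
have -> : (k.+1 - j).*2.-1 = (k - j).*2.+1 by lia.
have -> : (k.+1 - j).*2.+1 = (k - j.-1).*2.+1 by lia.
rewrite -signr_odd /= odd_double expr1 mulN1r => E.
apply: oppr_inj; rewrite opprB.
have -> : labcoef l (fun i => c i + uvec j i)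
  = coefx (fun i => l (lab i)) (fun i => c i + svec (k - j).*2.+1 i).
  by apply: eq_coefx => // i hi; rewrite uvec_odd //; lia.
have -> : labcoef l (fun i => c i + uvec j.-1 i)
  = coefx (fun i => l (lab i)) (fun i => c i + svec (k - j.-1).*2.+1 i).
  by apply: eq_coefx => // i hi; rewrite uvec_odd //; lia.
by rewrite E; case: eqP => // _; rewrite oppr0.
Qed.

End ClosedForm.

(** * Evaluation at powers of u and at reciprocals *)

Section Evaluation.
Variable k : nat.
Hypothesis k_gt0 : (0 < k)%N.

Implicit Types (L l : nat -> nat) (e c : nat -> int).

(** The entries alternate between 2 and -2 and the last one has half the size, so all tails are 1 or
    -1. *)
Lemma sum_dvec p : (p <= k)%N ->
  \sum_(p <= j < k.+1) dvec k j = (-1) ^+ p.+1 :> int.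
Proof.
move=> pk; elim: {p}(k - p)%N {-2}p (erefl (k - p)%N) pk => [|d IH] p Ed pk.
  have -> : p = k by lia.
  by rewrite big_nat1 /dvec eqxx mulr1.
rewrite big_ltn // IH; [|lia|lia].
have -> : dvec k p = (-1) ^+ p.+1 * 2.
  by rewrite /dvec; have -> : (p == k) = false by lia.
by rewrite [in X in _ + X]exprS; ring.
Qed.

Lemma sigcoef_unitv0 L e :
  sigcoef k L (fun m => e m - unitv 0 m) = sigcoef k L e.
Proof.
by apply: eq_sigcoef => j /andP[j0 _]; rewrite /unitv gtn_eqF // subr0.
Qed.

Lemma sigcoef_euler0 L e :
  \sum_(1 <= i < k.+1) (e i)%:~R * sigcoef k L (fun m => e m - unitv i m)
  = (\sum_(1 <= i < k.+1) e i - (csize k L)%:Z)%:~R * sigcoef k L e.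
Proof.
have := @sigcoef_euler k L e 0 isT; rewrite big_ltn // sigcoef_unitv0.
rewrite /slope [X in _ = (X - _)%:~R * _]big_ltn // -/(csize k L).
by move=> /(canRL (addKr _)) ->; rewrite !intrD; ring.
Qed.

(** The exponents are proportional to [dvec], so Euler's relation evaluates the very sum that occurs
    in the Jacobian. *)
Lemma coefPsi_dvec L (b : int) : b != 0 ->
  coefPsi k L (fun j => b * dvec k j)
  = (1 + 2 * (csize k L)%:R / b%:~R) * sigcoef k L (fun j => b * dvec k j).
Proof.
move=> b0; have b0' : b%:~R != 0 :> rat by rewrite intr_eq0.
set X := sigcoef _ _ _.
have E := sigcoef_euler0 L (fun j => b * dvec k j); rewrite -/X in E.
rewrite -mulr_sumr sum_dvec // sqrrN expr1n mulr1 in E.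
rewrite /coefPsi -/X.
under eq_bigr do rewrite mulrBr.
rewrite sumrB -mulr_suml -rmorph_sum /= sum_dvec // sqrrN expr1n mul1r.
set D := \sum_(1 <= i < k.+1) _.
have {}E : b%:~R * D = (b - (csize k L)%:Z)%:~R * X.
  rewrite -E mulr_sumr; apply: eq_bigr => i _.
  by rewrite intrM mulrA.
have -> : D = (b - (csize k L)%:Z)%:~R * X / b%:~R by rewrite -E mulrAC divff ?mul1r.
by rewrite intrB; field.
Qed.

(** The coefficients of U_k^a. The prefactor is 1 + 2 |L| / b for b = a - 2 |L|, with |L| the total
    content. *)
Lemma coefx_dvec L (a : nat) : ((csize k L).*2 != a)%N ->
  coefx k L (fun j => a%:Z * dvec k j)
  = a%:R / (a%:R - 2 * (csize k L)%:R) *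
    sigcoef k L (fun j => (a%:Z - (csize k L).*2%:Z) * dvec k j).
Proof.
move=> h; rewrite /coefx.
have E : coefPsi k L
    (fun j => a%:Z * dvec k j - (csize k L).*2%:Z * dvec k j)
  = coefPsi k L (fun j => (a%:Z - (csize k L).*2%:Z) * dvec k j).
  by apply: eq_coefPsi => // j _; rewrite mulrBl.
rewrite E coefPsi_dvec; last by rewrite subr_eq0; lia.
have h' : a%:R - 2 * (csize k L)%:R != 0 :> rat.
  by rewrite subr_eq0 -natrM eqr_nat; lia.
congr (_ * _); rewrite intrB -muln2 !pmulrn PoszM intrM /= -!pmulrn.
by rewrite [_%:R * 2]mulrC; field.
Qed.

(* The exponents that Lagrange inversion attaches to 1/u_(k+1-h), for the
   label h at the position i. *)
Definition rootvec (m i : nat) : nat -> int :=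
  fun j => - svec k i j - m.*2%:Z * dvec k j.

(** Origin of the factor 4n - 3 of the theorem: [m] will be n - 1. *)
Lemma rootvec_low m i j : (j < i <= k)%N ->
  rootvec m i j = (-1) ^+ j * (4 * m%:Z + 1).
Proof.
move=> /andP[ji ik]; rewrite /rootvec /svec /dvec ji.
have -> : (j == k) = false by lia.
rewrite -muln2 PoszM !exprS exprD -(signr_odd _ i).
by case: (odd i) => /=; rewrite ?expr0 ?expr1; ring.
Qed.

Lemma rootvec_high m i j : (i <= j)%N ->
  rootvec m i j = - (m.*2 + odd i)%:Z * dvec k j.
Proof.
by move=> ij; rewrite /rootvec /svec ltnNge ij /=; case: (odd i); lia.
Qed.

Lemma sum_rootvec_high m i p : (i <= p <= k)%N ->
  \sum_(p <= j < k.+1) rootvec m i j = (-1) ^+ p * (m.*2 + odd i)%:Z.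
Proof.
move=> /andP[ip pk].
rewrite (eq_big_nat _ _ (F2 := fun j => - (m.*2 + odd i)%:Z * dvec k j)).
  by rewrite -mulr_sumr sum_dvec // exprS; ring.
by move=> j hj; apply: rootvec_high; lia.
Qed.

Lemma sum_rootvec_low m i p : (p < i <= k)%N ->
  \sum_(p <= j < k.+1) rootvec m i j
  = if odd p then - (m.*2.+1)%:Z else m.*2%:Z.
Proof.
move=> /andP[pi ik].
elim: {p}(i - p)%N {-2}p (erefl (i - p)%N) pi => [|d IH] p Ed pi; first by lia.
rewrite big_ltn ?rootvec_low ?pi //; last by lia.
case: (ltngtP p.+1 i) => h; [|lia|].
  rewrite IH //; last by lia.
  by rewrite -(signr_odd _ p) /=; case: (odd p) => /=; rewrite ?expr0 ?expr1; lia.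
rewrite h sum_rootvec_high ?leqnn // -h /= -(signr_odd _ p).
rewrite -(signr_odd _ p.+1) /=.
by case: (odd p) => /=; rewrite ?expr0 ?expr1; lia.
Qed.

(** The Jacobian sum [D] is no longer a multiple of the Euler sum. It satisfies two linear equations
    together with the alternating sum [T] over the positions before [i], while Euler's relation from
    [i] onwards evaluates the remaining tail as [G]. Eliminating [T] leaves [X] and [G], the two
    terms of the final formulas. *)
Lemma coefx_root L i (m := csize k L) : (0 < i <= k)%N -> (0 < m)%N ->
  coefx k L (fun j => - svec k i j)
  = - sigcoef k L (rootvec m i) / (4 * m%:R + 1)
    + (-1) ^+ i * (2 * ((slope k L (rootvec m i) i)%:~R
                * sigcoef k L (fun j => rootvec m i j - unitv i j)))
      / ((m.*2 + odd i)%:R * (4 * m%:R + 1)).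
Proof.
move=> /andP[i0 ik] m0; rewrite /coefx -/m -/(rootvec m i) /coefPsi.
set e := rootvec m i; set X := sigcoef k L e; set G := _%:~R * _.
pose Y j := sigcoef k L (fun n => e n - unitv j n).
under eq_bigr do rewrite mulrBr -/(Y _).
rewrite sumrB -mulr_suml -rmorph_sum /= sum_dvec // sqrrN expr1n mul1r.
set D := \sum_(1 <= j < k.+1) (dvec k j)%:~R * Y j.
pose T := \sum_(1 <= j < i) (-1) ^+ j * Y j.
have i1 : (1 <= i)%N by [].
have iS : (i <= k.+1)%N by lia.
have EG : \sum_(i <= j < k.+1) (e j)%:~R * Y j = G by apply: sigcoef_euler.
have E1 : \sum_(1 <= j < k.+1) (e j)%:~R * Y j = - (3 * m%:R + 1) * X.
  rewrite sigcoef_euler0 -/m; congr (_ * _).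
  (* Summing from position 0 and removing its value 4m + 1 covers the case [i = 1] as well. *)
  have := sum_rootvec_low m (p := 0) (i := i); rewrite i0 ik => /(_ isT) /=.
  rewrite big_ltn // rootvec_low ?i0 // expr0 mul1r -/e.
  move=> /(canRL (addKr _)) ->.
  have -> : - (4 * m%:Z + 1) + m.*2%:Z - m%:Z = - (3 * m%:Z + 1) by lia.
  by rewrite intrN intrD intrM.
have ET : (4 * m%:R + 1) * T + G = - (3 * m%:R + 1) * X.
  rewrite -E1 (big_cat_nat i1 iS) /= EG; congr (_ + _).
  rewrite mulr_sumr; apply: eq_big_nat => j /andP[j1 ji].
  rewrite /e rootvec_low ?ji // intrM rmorphXn /= rmorphN1 intrD intrM.
  by rewrite mulrCA mulrA [_ * (_ + _)]mulrC.
(* The sum of [E1] again, with the exponents compared to a multiple of [dvec] at all positions; the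
   deviation before [i] is a sign, which produces [T]. *)
have ED : - (m.*2 + odd i)%:R * D - (-1) ^+ i.+1 * T = - (3 * m%:R + 1) * X.
  rewrite -E1 /D /T (big_cat_nat i1 iS) /= [in RHS](big_cat_nat i1 iS) /=.
  rewrite mulrDr addrAC; congr (_ + _).
    rewrite !mulr_sumr -sumrB; apply: eq_big_nat => j /andP[j1 ji].
    have -> : e j = - (m.*2 + odd i)%:Z * dvec k j - (-1) ^+ i.+1 * (-1) ^+ j.
      rewrite /e rootvec_low ?ji // /dvec; have -> : (j == k) = false by lia.
      have -> : (m.*2 + odd i)%:Z = 2 * m%:Z + (odd i)%:R.
        by case: (odd i); lia.
      rewrite subr0 !exprS -(signr_odd _ i).
      by case: (odd i); rewrite ?expr0 ?expr1 /=; ring.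
    rewrite intrB !intrM !rmorphXn /= rmorphN1 intrN -pmulrn; ring.
  rewrite mulr_sumr; apply: eq_big_nat => j /andP[j1 ji].
  by rewrite /e rootvec_high // [in RHS]intrM intrN -pmulrn mulrA.
have m4 : 4 * m%:R + 1 != 0 :> rat by rewrite -natrM natr1 pnatr_eq0.
have mK : (m.*2 + odd i)%:R != 0 :> rat by rewrite pnatr_eq0; lia.
have ET' : T = - ((3 * m%:R + 1) * X + G) / (4 * m%:R + 1).
  apply: (mulfI m4); rewrite mulrCA divff // mulr1.
  by move: ET => /(canRL (addrK _)) ->; ring.
have ED' : D = ((3 * m%:R + 1) * X - (-1) ^+ i.+1 * T) / (m.*2 + odd i)%:R.
  apply: (mulfI mK); rewrite mulrCA divff // mulr1.
  by apply: oppr_inj; move: ED; rewrite mulNr => /(canRL (subrK _)) ->; ring.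
have Eb : (m.*2 + odd i)%:R = 2 * m%:R + (odd i)%:R :> rat.
  by rewrite natrD -muln2 natrM mulrC.
rewrite ED' ET' exprS -(signr_odd _ i) Eb; rewrite Eb in mK.
by case: (odd i) mK; rewrite ?mulr0n ?mulr1n ?addr0 ?expr0 ?expr1 => mK;
  field; rewrite ?m4 ?mK ?pnatr_eq0 -?lt0n ?m0.
Qed.
End Evaluation.

(** * From positions of the chain to the products of binomials *)

Section Products.
Variables (k : nat) (l : nat -> nat).
Hypothesis k_gt0 : (0 < k)%N.

Let L i := l (lab k i).
Let n := csize k l.

Lemma lab_odd r : (0 < r)%N -> lab k r.*2.-1 = r.
Proof.
by case: r => // r _; rewrite /lab doubleS /= odd_double /= doubleK.
Qed.

Lemma lab_even r : lab k r.*2 = (k.+1 - r)%N.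
Proof. by rewrite /lab odd_double doubleK. Qed.

(** The first 2r positions carry the labels 1 to r and k+1-r to k. *)
Lemma prefix_sumB r : (r.*2 <= k)%N ->
  (\sum_(1 <= p < r.*2.+1) L p)%N = sumB k l r.
Proof.
elim: r => [|r IH] hr; first by rewrite /sumB !big_geq ?subn0.
rewrite doubleS big_nat_recr //= big_nat_recr //= IH; last by lia.
have -> : L r.*2.+1 = l r.+1 by rewrite /L -(@lab_odd r.+1).
have -> : L r.*2.+2 = l (k - r)%N by rewrite /L -doubleS lab_even subSS.
have -> : sumB k l r.+1 = (l r.+1 + l (k - r) + sumB k l r)%N.
  rewrite /sumB big_nat_recr // subSS (big_ltn (m := (k - r)%N)); last by lia.
  have -> : (k.+1 - r = (k - r).+1)%N by lia.
  by rewrite /=; lia.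
by lia.
Qed.

Lemma prefix_sumA r : (0 < r)%N -> (r.*2.-1 <= k)%N ->
  (\sum_(1 <= p < r.*2.-1) L p)%N = sumA k l r.
Proof.
case: r => // r _ hr; rewrite doubleS /= prefix_sumB; last by lia.
by rewrite /sumA /sumB subSS.
Qed.

Lemma csize_lab : csize k L = n.
Proof.
rewrite /n /csize; have := odd_double_half k; case: (odd k) => /= Ek.
  rewrite -{1}Ek add1n big_nat_recr //= prefix_sumB; last by lia.
  have -> : L (k./2).*2.+1 = l (k./2).+1 by rewrite /L -(@lab_odd (k./2).+1).
  rewrite /sumB (@big_cat_nat _ _ _ (k./2).+1 1 k.+1) //=; last by lia.
  rewrite [X in _ = (_ + X)%N]big_ltn; last by lia.
  have -> : (k.+1 - k./2 = (k./2).+2)%N by lia.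
  by rewrite -addnA [X in (_ + X)%N]addnC.
rewrite -{1}Ek add0n prefix_sumB; last by lia.
rewrite /sumB (@big_cat_nat _ _ _ (k./2).+1 1 k.+1) //=; last by lia.
by have -> : (k.+1 - k./2 = (k./2).+1)%N by lia.
Qed.

Lemma prod_positions (F : nat -> rat) :
  \prod_(1 <= p < k.+1) F p
  = \prod_(1 <= r < (uphalf k).+1) F r.*2.-1
    * \prod_(1 <= r < (k./2).+1) F r.*2.
Proof.
have E m : \prod_(1 <= p < m.*2.+1) F p
  = \prod_(1 <= r < m.+1) F r.*2.-1 * \prod_(1 <= r < m.+1) F r.*2.
  elim: m => [|m IH]; first by rewrite !big_geq // mulr1.
  rewrite doubleS (@big_nat_recr _ _ _ m.*2.+2) //= (@big_nat_recr _ _ _ m.*2.+1) //= IH.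
  by rewrite !(@big_nat_recr _ _ _ m.+1) //=; ring.
have := odd_double_half k; rewrite uphalf_half.
case: (odd k) => /= Ek; last by rewrite -{1}Ek !add0n E.
rewrite -{1}Ek !add1n big_nat_recr //= E; symmetry.
by rewrite big_nat_recr //= mulrAC.
Qed.

Definition factor L' e p : rat :=
  (-1) ^+ (odd p * L' p) * binq (slope k L' e p) (L' p).

Lemma sigcoef_factor L' e : sigcoef k L' e
  = \prod_(1 <= r < (uphalf k).+1) factor L' e r.*2.-1
    * \prod_(1 <= r < (k./2).+1) factor L' e r.*2.
Proof. by rewrite -prod_positions. Qed.

Lemma factor_odd L' e c r : (0 < r)%N -> L' r.*2.-1 = l r ->
    slope k L' e r.*2.-1 = (l r)%:Z - 1 - 3 * n%:Z + c%:Z + (sumA k l r)%:Z ->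
  factor L' e r.*2.-1 = binA n k l c r.
Proof.
move=> r0 EL Es; rewrite /factor EL Es.
have -> : odd r.*2.-1 by case: r r0 {EL Es} => // r _; rewrite /= odd_double.
by rewrite mul1n -[X in binq X]opprK binq_neg; congr (binq _ _); lia.
Qed.

Lemma factor_even L' e c r : L' r.*2 = l (k.+1 - r)%N ->
    slope k L' e r.*2 = n%:Z - c%:Z + (sumB k l r)%:Z ->
  factor L' e r.*2 = binB n k l c r.
Proof.
by move=> EL Es; rewrite /factor EL Es odd_double mul0n expr0 mul1r.
Qed.

(** The total content is n, so the tail of [L] in the slope can be traded for a prefix, and the
    prefixes are [sumA] and [sumB]. *)
Lemma slope_prefix e p : (p <= k)%N ->
  slope k L e p = \sum_(p <= j < k.+1) e j - n%:Z
                  + (\sum_(1 <= j < p.+1) L j)%N%:Z.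
Proof.
move=> pk; rewrite /slope -csize_lab /csize.
rewrite (@big_cat_nat _ _ _ p.+1 1 k.+1) //= PoszD; ring.
Qed.

Lemma slope_odd e r : (0 < r)%N -> (r.*2.-1 <= k)%N ->
  slope k L e r.*2.-1 = \sum_(r.*2.-1 <= j < k.+1) e j - n%:Z
                  + (sumA k l r)%:Z + (l r)%:Z.
Proof.
move=> r0 rk; rewrite slope_prefix //.
rewrite [(\sum_(1 <= j < _) L j)%N]big_nat_recr /=; last by lia.
by rewrite prefix_sumA // PoszD addrA /L lab_odd.
Qed.

Lemma slope_even e r : (r.*2 <= k)%N ->
  slope k L e r.*2 = \sum_(r.*2 <= j < k.+1) e j - n%:Z + (sumB k l r)%:Z.
Proof. by move=> rk; rewrite slope_prefix // prefix_sumB. Qed.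

Lemma labcoef_u (a : nat) : (a < n.*2)%N ->
  labcoef k l (fun j => a%:Z * dvec k j)
  = a%:R / (a%:R - 2 * n%:R)
    * (\prod_(1 <= r < (uphalf k).+1) binA n k l a.+1 r
      * \prod_(1 <= r < (k./2).+1) binB n k l a r).
Proof.
move=> an; rewrite /labcoef coefx_dvec // csize_lab; last by lia.
congr (_ * _); rewrite sigcoef_factor; congr (_ * _).
  apply: eq_big_nat => r; rewrite uphalf_half => hr.
  have hk : (r.*2.-1 <= k)%N by have := odd_double_half k; lia.
  have r0 : (0 < r)%N by lia.
  apply: factor_odd => //; first by rewrite lab_odd.
  rewrite slope_odd // -mulr_sumr sum_dvec // prednK ?double_gt0 //.
  by rewrite -signr_odd odd_double expr0 mulr1; lia.
apply: eq_big_nat => r hr.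
have hk : (r.*2 <= k)%N by have := odd_double_half k; lia.
apply: factor_even => //; first by rewrite lab_even.
rewrite slope_even // -mulr_sumr sum_dvec //.
by rewrite -signr_odd /= odd_double expr1; lia.
Qed.

End Products.

(** * The formula for a prescribed root label *)

Section RootFormula.
Variables (k : nat) (l : nat -> nat) (h : nat).
Hypotheses (k_gt0 : (0 < k)%N) (hk : (0 < h <= k)%N) (lh : (0 < l h)%N).

Let L i := l (lab k i).
Let n := csize k l.
Let i := lpos k h.
Let e := rootvec k n.-1 i.

Hypothesis n_gt1 : (1 < n)%N.

Let ik : (0 < i <= k)%N. Proof. exact: lpos_bound. Qed.
Let Li : (0 < L i)%N. Proof. by rewrite /L lposK. Qed.

(** The root takes away one vertex labelled h, so [coefx_root] is applied with m = n - 1, and 4m + 1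
    becomes 4n - 3. *)
Lemma labcoef_root :
  labcoef k (decr h l) (fun j => - uvec k (k.+1 - h) j)
  = - sigcoef k (decr i L) e / (4 * n%:R - 3)
    + (-1) ^+ i * (2 * ((slope k (decr i L) e i)%:~R
                * sigcoef k (decr i L) (fun j => e j - unitv i j)))
      / (((n.-1).*2 + odd i)%:R * (4 * n%:R - 3)).
Proof.
have Em : csize k (decr i L) = n.-1.
  by have := csize_decr ik Li; rewrite csize_lab // -/n => ->.
have -> : labcoef k (decr h l) (fun j => - uvec k (k.+1 - h) j)
   = coefx k (decr i L) (fun j => - svec k i j).
  apply: eq_coefx => j hj.
    rewrite /decr /L; congr (_ - nat_of_bool _)%N.
    by apply/eqP/eqP => [E|->]; rewrite ?lposK // /i -E labK.
  rewrite /i /lpos; case: leqP => h1; last by rewrite uvec_even //; lia.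
  by rewrite uvec_odd //; [congr (- svec _ _ _)|..]; lia.
rewrite coefx_root // Em -/e; last by lia.
have -> : 4 * n.-1%:R + 1 = 4 * n%:R - 3 :> rat.
  by rewrite -[n in RHS]prednK ?(ltnW n_gt1) // -natr1; ring.
by [].
Qed.

Let pA r : (0 < r < (uphalf k).+1)%N -> (0 < r)%N /\ (r.*2.-1 <= k)%N.
Proof. by rewrite uphalf_half => hr; have := odd_double_half k; lia. Qed.

Let pB r : (0 < r < (k./2).+1)%N -> (r.*2 <= k)%N.
Proof. by move=> hr; have := odd_double_half k; lia. Qed.

Let decrE p : p != i -> decr i L p = L p.
Proof. by move=> /negPf pi; rewrite /decr pi subn0. Qed.

Let oddA r : (0 < r)%N -> odd r.*2.-1.
Proof. by case: r => // r _; rewrite /= odd_double. Qed.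

(* [d = 1] for the exponent vector [e - unitv i] and [d = 0] for [e]. *)
Let shifted (d : bool) : nat -> int := fun j => e j - d%:R * unitv i j.

Let slope_shifted d p : slope k (decr i L) (shifted d) p
  = slope k L e p + (p < i)%:R - d%:R * (p <= i)%:R.
Proof.
have /andP[_ ik'] := ik.
by rewrite slope_decr // slope_add sumrN -mulr_sumr sum_unitv // addrAC.
Qed.

(** Before position [i] the upper arguments depend on [d], after it on the parity of [i]. This is
    why products in the theorem are split according to h. *)
Lemma factor_low_odd (d : bool) r : (0 < r < (uphalf k).+1)%N ->
  (r.*2.-1 < i)%N ->
  factor k (decr i L) (shifted d) r.*2.-1 = binA n k l (3 - d) r.
Proof.
move=> hr ri; have [r0 rk] := pA hr; apply: factor_odd => //.
  by rewrite decrE ?ltn_eqF // /L lab_odd.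
rewrite slope_shifted slope_odd // sum_rootvec_low //; last by lia.
by rewrite oddA // ri ltnW // -/n; move: n_gt1; case: d; lia.
Qed.

Lemma factor_low_even (d : bool) r : (r.*2 < i)%N ->
  factor k (decr i L) (shifted d) r.*2 = binB n k l d.+1 r.
Proof.
move=> ri; have rk : (r.*2 <= k)%N by lia.
apply: factor_even; first by rewrite decrE ?ltn_eqF // /L lab_even.
rewrite slope_shifted slope_even // sum_rootvec_low //; last by lia.
by rewrite odd_double ri ltnW // -/n; move: n_gt1; case: d; lia.
Qed.

Lemma factor_high_odd (d : bool) r : (0 < r < (uphalf k).+1)%N ->
  (i < r.*2.-1)%N ->
  factor k (decr i L) (shifted d) r.*2.-1 = binA n k l (3 - odd i) r.
Proof.
move=> hr ri; have [r0 rk] := pA hr; apply: factor_odd => //.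
  by rewrite decrE ?gtn_eqF // /L lab_odd.
rewrite slope_shifted slope_odd // sum_rootvec_high //; last by lia.
rewrite -signr_odd oddA // expr1 !ltnNge ltnW //= leqNgt ri /=.
by rewrite -/n; move: n_gt1; case: (odd i); case: d; lia.
Qed.

Lemma factor_high_even (d : bool) r : (0 < r < (k./2).+1)%N ->
  (i < r.*2)%N ->
  factor k (decr i L) (shifted d) r.*2 = binB n k l (2 - odd i) r.
Proof.
move=> /pB rk ri; apply: factor_even.
  by rewrite decrE ?gtn_eqF // /L lab_even.
rewrite slope_shifted slope_even // sum_rootvec_high //; last by lia.
rewrite -signr_odd odd_double expr0 !ltnNge ltnW //= leqNgt ri /=.
by rewrite -/n; move: n_gt1; case: (odd i); case: d; lia.
Qed.

Let slope_decr_i : slope k (decr i L) e i = slope k L e i.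
Proof. by case/andP: ik => _ ?; rewrite slope_decr // ltnn addr0. Qed.

Let decr_i : decr i L i = (l h).-1.
Proof. by rewrite /decr eqxx subn1 /L lposK. Qed.

Let sumA_le r : (0 < r)%N -> (r.*2.-1 <= k)%N -> (sumA k l r <= n)%N.
Proof.
move=> r0 rk; rewrite -prefix_sumA // /n -csize_lab // /csize.
by rewrite [X in (_ <= X)%N](@big_cat_nat _ _ _ r.*2.-1) ?leq_addr //=; lia.
Qed.

(** At position [i] the lower index is l_h - 1. Absorption raises it to l_h and brings in the factor
    l_h; when [d] is false it also divides by the upper argument, which is the denominator 3n - 2 -
    [sumA]. *)
Lemma factor_root_odd (d : bool) : odd i ->
  (if d then (slope k (decr i L) e i)%:~R else 1)
    * factor k (decr i L) (shifted d) i
  = (if d then - 1 else (3 * n%:R - 2 - (sumA k l h)%:R)^-1)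
    * (l h)%:R * binA n k l 2 h.
Proof.
move=> io; have /andP[i0 ik'] := ik; have /andP[h0 _] := hk.
have Ei : i = h.*2.-1.
  by move: io; rewrite /i /lpos; case: ifP => // _; rewrite odd_double.
rewrite /factor slope_shifted ltnn leqnn addr0 mulr1 slope_decr_i decr_i io mul1n.
set s := slope k L e i.
have Es : s = (l h)%:Z - (3 * n%:Z - 1 - (sumA k l h)%:Z).
  rewrite /s {1}Ei slope_odd // -?Ei // sum_rootvec_high ?leqnn //.
  by rewrite -signr_odd io expr1 -/n; move: n_gt1; lia.
have hA : (sumA k l h <= n)%N by apply: sumA_le; rewrite -?Ei.
have -> : 3 * n%:R - 2 - (sumA k l h)%:R
    = (3 * n%:Z - 2 - (sumA k l h)%:Z)%:~R :> rat.
  by rewrite !intrB intrM.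
rewrite /binA; case: (l h) lh Es => // b _ Es; rewrite -pred_Sn.
case: d; rewrite ?mul0r ?subr0 ?mul1r.
  have <- : (-1) ^+ b.+1 * binq s b.+1
      = binq (3 * n%:Z - 2%:Z - (sumA k l h)%:Z) b.+1.
    by rewrite -[s]opprK binq_neg; congr (binq _ _); lia.
  by rewrite mulrCA -binqSl exprS; ring.
rewrite -[s]opprK binq_neg; set a := 3 * _ - _ - _.
(* Positive, as [sumA] is at most n and n > 1. *)
have a0 : a%:~R != 0 :> rat by rewrite intr_eq0 /a; move: n_gt1; lia.
rewrite -mulrA binqSl mulKf //; congr (binq _ _); rewrite /a; lia.
Qed.

Lemma factor_root_even (d : bool) (r := (k.+1 - h)%N) : ~~ odd i ->
  (if d then (slope k (decr i L) e i)%:~R else 1)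
    * factor k (decr i L) (shifted d) i
  = (if d then 1 else (n%:R - 1 + (sumB k l r)%:R)^-1)
    * (l h)%:R * binB n k l d.+1 r.
Proof.
move=> io; have /andP[i0 ik'] := ik; have /andP[h0 hk'] := hk.
have Ei : i = r.*2.
  move: io; rewrite /i /lpos; case: ifP => // _.
  by case: (h) h0 => // h' _; rewrite /= odd_double.
rewrite /factor slope_shifted ltnn leqnn addr0 mulr1 slope_decr_i decr_i.
rewrite (negPf io) mul0n expr0 mul1r.
set s := slope k L e i.
have Es : s = n%:Z - 2 + (sumB k l r)%:Z.
  rewrite /s {1}Ei slope_even // -?Ei // sum_rootvec_high ?leqnn //.
  by rewrite -signr_odd (negPf io) expr0 -/n; move: n_gt1; lia.
have -> : n%:R - 1 + (sumB k l r)%:R = (s + 1)%:~R :> rat.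
  have -> : s + 1 = n%:Z - 1 + (sumB k l r)%:Z by lia.
  by rewrite intrD intrB.
rewrite /binB; have -> : (k.+1 - r = h)%N by rewrite /r; lia.
case: (l h) lh => // b _; rewrite -pred_Sn.
case: d; rewrite ?mul0r ?subr0 ?mul1r.
  by rewrite -binqSl Es.
have a0 : (s + 1)%:~R != 0 :> rat by rewrite intr_eq0 Es; move: n_gt1; lia.
have -> : n%:Z - 1%:Z + (sumB k l r)%:Z = s + 1 by rewrite Es; lia.
by rewrite -mulrA binqSl addrK mulKf.
Qed.

Let sigcoef_shifted0 :
  sigcoef k (decr i L) e = sigcoef k (decr i L) (shifted false).
Proof. by apply: eq_sigcoef => j _; rewrite /shifted mul0r subr0. Qed.

Let sigcoef_shifted1 : sigcoef k (decr i L) (fun j => e j - unitv i j)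
  = sigcoef k (decr i L) (shifted true).
Proof. by apply: eq_sigcoef => j _; rewrite /shifted mul1r. Qed.

Let prod_odd (d : bool) : odd i ->
  (if d then (slope k (decr i L) e i)%:~R else 1)
    * sigcoef k (decr i L) (shifted d)
  = (if d then - 1 else (3 * n%:R - 2 - (sumA k l h)%:R)^-1) * (l h)%:R
   * (\prod_(1 <= r < h) binA n k l (3 - d) r
      * \prod_(h <= r < (uphalf k).+1) binA n k l 2 r
      * (\prod_(1 <= r < h) binB n k l d.+1 r
         * \prod_(h <= r < (k./2).+1) binB n k l 1 r)).
Proof.
move=> io; have /andP[i0 ik'] := ik; have /andP[h0 _] := hk.
have Ei : i = h.*2.-1.
  by move: io; rewrite /i /lpos; case: ifP => // _; rewrite odd_double.
have hu : (h <= uphalf k)%N.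
  by rewrite uphalf_half; have := odd_double_half k; lia.
have hk2 : (h <= (k./2).+1)%N by have := odd_double_half k; lia.
rewrite sigcoef_factor (big_cat_nat h0 (leqW hu)) /=.
rewrite [X in _ * (_ * X * _)]big_ltn // -Ei.
rewrite (big_cat_nat h0 hk2) /= [in RHS](@big_ltn _ _ _ h) //.
set P1 := \prod_(1 <= r < h) _; set P2 := \prod_(h.+1 <= r < _) _.
set P3 := \prod_(1 <= r < h) _; set P4 := \prod_(h <= r < _) _.
have -> : P1 = \prod_(1 <= r < h) binA n k l (3 - d) r.
  by apply: eq_big_nat => r hr; apply: factor_low_odd; lia.
have -> : P2 = \prod_(h.+1 <= r < (uphalf k).+1) binA n k l 2 r.
  by apply: eq_big_nat => r hr; rewrite factor_high_odd ?io //; lia.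
have -> : P3 = \prod_(1 <= r < h) binB n k l d.+1 r.
  by apply: eq_big_nat => r hr; apply: factor_low_even; lia.
have -> : P4 = \prod_(h <= r < (k./2).+1) binB n k l 1 r.
  by apply: eq_big_nat => r hr; rewrite factor_high_even ?io //; lia.
have E := factor_root_odd d io.
set G := (if d then _ else 1) in E *; set F := factor _ _ _ _ in E *.
transitivity (G * F * (\prod_(1 <= r < h) binA n k l (3 - d) r
   * \prod_(h.+1 <= r < (uphalf k).+1) binA n k l 2 r
   * (\prod_(1 <= r < h) binB n k l d.+1 r
      * \prod_(h <= r < (k./2).+1) binB n k l 1 r))); first by ring.
by rewrite E; move: (if d then _ else _) => c; ring.
Qed.

Let prod_even (d : bool) : ~~ odd i ->
  (if d then (slope k (decr i L) e i)%:~R else 1)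
    * sigcoef k (decr i L) (shifted d)
  = (if d then 1 else (n%:R - 1 + (sumB k l (k.+1 - h))%:R)^-1) * (l h)%:R
   * (\prod_(1 <= r < k.+2 - h) binA n k l (3 - d) r
      * \prod_(k.+2 - h <= r < (uphalf k).+1) binA n k l 3 r
      * (\prod_(1 <= r < k.+2 - h) binB n k l d.+1 r
         * \prod_(k.+2 - h <= r < (k./2).+1) binB n k l 2 r)).
Proof.
move=> io; have /andP[i0 ik'] := ik; have /andP[h0 hk'] := hk.
set q := (k.+1 - h)%N.
have -> : (k.+2 - h = q.+1)%N by rewrite /q; lia.
have q0 : (0 < q)%N by rewrite /q; lia.
have Ei : i = q.*2.
  move: io; rewrite /i /lpos; case: ifP => // _.
  by case: (h) h0 => // h' _; rewrite /= odd_double.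
have qu : (q <= uphalf k)%N.
  by rewrite uphalf_half; have := odd_double_half k; lia.
have qk2 : (q <= k./2)%N by have := odd_double_half k; lia.
rewrite sigcoef_factor (@big_cat_nat _ _ _ q.+1 1 (uphalf k).+1) //=.
rewrite (@big_cat_nat _ _ _ q.+1 1 (k./2).+1) //=.
rewrite [X in _ * (_ * (X * _))]big_nat_recr //= -Ei.
rewrite [\prod_(1 <= r < q.+1) binB _ _ _ _ _]big_nat_recr //=.
set P1 := \prod_(1 <= r < q.+1) _; set P2 := \prod_(q.+1 <= r < _) _.
set P3 := \prod_(1 <= r < q) _; set P4 := \prod_(q.+1 <= r < _) _.
have -> : P1 = \prod_(1 <= r < q.+1) binA n k l (3 - d) r.
  by apply: eq_big_nat => r hr; apply: factor_low_odd; lia.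
have -> : P2 = \prod_(q.+1 <= r < (uphalf k).+1) binA n k l 3 r.
  by apply: eq_big_nat => r hr; rewrite factor_high_odd ?(negPf io) //; lia.
have -> : P3 = \prod_(1 <= r < q) binB n k l d.+1 r.
  by apply: eq_big_nat => r hr; apply: factor_low_even; lia.
have -> : P4 = \prod_(q.+1 <= r < (k./2).+1) binB n k l 2 r.
  by apply: eq_big_nat => r hr; rewrite factor_high_even ?(negPf io) //; lia.
have E := factor_root_even d io; rewrite -/q in E.
set G := (if d then _ else 1) in E *; set F := factor _ _ _ _ in E *.
transitivity (G * F * (\prod_(1 <= r < q.+1) binA n k l (3 - d) r
   * \prod_(q.+1 <= r < (uphalf k).+1) binA n k l 3 r
   * (\prod_(1 <= r < q) binB n k l d.+1 r
      * \prod_(q.+1 <= r < (k./2).+1) binB n k l 2 r))); first by ring.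
by rewrite E; move: (if d then _ else _) => c; ring.
Qed.

(** These labels stand at odd positions, so 2m + 1 = 2n - 1 appears in the denominator; the sign of
    [labcoef_root] cancels that of [factor_root_odd]. *)
Lemma labcoef_root_low : (h <= uphalf k)%N ->
  labcoef k (decr h l) (fun j => - uvec k (k.+1 - h) j) =
    2 * (l h)%:R / ((2 * n%:R - 1) * (4 * n%:R - 3))
      * (\prod_(1 <= r < (uphalf k).+1) binA n k l 2 r)
      * (\prod_(1 <= r < h) binB n k l 2 r)
      * (\prod_(h <= r < (k./2).+1) binB n k l 1 r)
    - (l h)%:R / ((4 * n%:R - 3) * (3 * n%:R - 2 - (sumA k l h)%:R))
      * (\prod_(1 <= r < (k./2).+1) binB n k l 1 r)
      * (\prod_(1 <= r < h) binA n k l 3 r)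
      * (\prod_(h <= r < (uphalf k).+1) binA n k l 2 r).
Proof.
move=> hu; have /andP[h0 _] := hk.
have Ei : i = h.*2.-1.
  rewrite /i /lpos; case: ifP => // /negP[]; move: hu; rewrite uphalf_half.
  by have := odd_double_half k; lia.
have io : odd i by rewrite Ei oddA.
have hk2 : (h <= (k./2).+1)%N.
  by have := odd_double_half k; move: hu; rewrite uphalf_half; lia.
have E0 := prod_odd false io; have E1 := prod_odd true io.
rewrite mul1r -sigcoef_shifted0 in E0; rewrite -sigcoef_shifted1 in E1.
rewrite labcoef_root E0 E1 -signr_odd io expr1.
rewrite (big_cat_nat h0 (leqW hu)) /= (big_cat_nat h0 hk2) /= !subn0 subn1.
have -> : (n.-1.*2 + true)%:R = 2 * n%:R - 1 :> rat.
  have -> : (n = n.-1.+1)%N by move: n_gt1; lia.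
  by rewrite addn1 -pred_Sn -!natr1 -muln2 natrM; ring.
set a := 3 * _ - _ - _; set b := 4 * _ - _; set c := 2 * _ - _.
by rewrite !invfM; ring.
Qed.

(** These labels stand at even positions; the denominator 2m = 2(n - 1) cancels the 2 of the
    Jacobian. *)
Lemma labcoef_root_high : (uphalf k < h)%N ->
  labcoef k (decr h l) (fun j => - uvec k (k.+1 - h) j) =
    (l h)%:R / ((n%:R - 1) * (4 * n%:R - 3))
      * (\prod_(1 <= r < (k./2).+1) binB n k l 2 r)
      * (\prod_(1 <= r < k.+2 - h) binA n k l 2 r)
      * (\prod_(k.+2 - h <= r < (uphalf k).+1) binA n k l 3 r)
    - (l h)%:R / ((4 * n%:R - 3)
                  * (n%:R - 1 + (sumB k l (k.+1 - h)%N)%:R))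
      * (\prod_(1 <= r < (uphalf k).+1) binA n k l 3 r)
      * (\prod_(1 <= r < k.+2 - h) binB n k l 1 r)
      * (\prod_(k.+2 - h <= r < (k./2).+1) binB n k l 2 r).
Proof.
move=> hu; have /andP[h0 hk'] := hk; rewrite uphalf_half in hu *.
have Ok := odd_double_half k.
have Ei : i = (k.+1 - h).*2.
  by rewrite /i /lpos; case: ifP => //; lia.
have io : ~~ odd i by rewrite Ei odd_double.
have h1 : (1 <= k.+2 - h)%N by lia.
have h2 : (k.+2 - h <= (odd k + k./2).+1)%N by lia.
have h3 : (k.+2 - h <= (k./2).+1)%N by lia.
have E0 := prod_even false io; have E1 := prod_even true io.
rewrite uphalf_half in E0 E1.
rewrite mul1r -sigcoef_shifted0 in E0; rewrite -sigcoef_shifted1 in E1.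
rewrite labcoef_root E0 E1 -signr_odd (negPf io) expr0.
rewrite (big_cat_nat h1 h2) /= (big_cat_nat h1 h3) /= !subn0 subn1 addn0.
have -> : (n.-1.*2)%:R = 2 * (n%:R - 1) :> rat.
  have -> : (n = n.-1.+1)%N by move: n_gt1; lia.
  by rewrite -pred_Sn -!natr1 -muln2 natrM; ring.
set a := _ - 1 + _; set b := 4 * _ - _; set c := _ - 1.
by rewrite !invfM; move: a^-1 b^-1 c^-1 => a1 b1 c1; field.
Qed.

End RootFormula.

(** * Uniqueness of the solution of the recurrences *)

Section Uniqueness.
Variables (k N : nat) (A : comPzRingType).
Variables (phi : (nat -> nat) -> A -> rat) (U Q : nat -> A).

Hypothesis k_gt0 : (0 < k)%N.
Hypothesis phiB : forall l a b, phi l (a - b) = phi l a - phi l b.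
Hypothesis phi1 : forall l, phi l 1 = (csize k l == 0)%N%:R.
Hypothesis U0 : U 0 = 1.
Hypothesis Q0 : Q 0 = 1.
Hypothesis phi_inv : forall l j a, (csize k l <= N)%N -> (j <= k)%N ->
  phi l (a * U j * Q j) = phi l a.
Hypothesis phi_step : forall l j a, (csize k l <= N)%N -> (0 < j <= k)%N ->
  phi l (a * (U j.-1 - U j))
  = if l j == 0%N then 0 else phi (decr j l) (a * Q k * Q (k.+1 - j)).

Let expo (s t : seq nat) (i : nat) : int :=
  \sum_(j <- s) uvec k j i - \sum_(j <- t) uvec k j i.

Let mono (s t : seq nat) : A := \prod_(j <- s) U j * \prod_(j <- t) Q j.

(** For a nonempty content the prefactor a / (a - 2 |L|) vanishes at a = 0. *)
Lemma labcoef0 l : labcoef k l (fun _ => 0) = (csize k l == 0)%N%:R.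
Proof.
have E : labcoef k l (fun _ => 0) = labcoef k l (fun j => 0%:Z * dvec k j).
  by apply: eq_coefx => // j _; rewrite mul0r.
rewrite E; have [l0|l0] := eqVneq (csize k l) 0%N; last first.
  rewrite /labcoef coefx_dvec // ?mul0r // csize_lab // -double0.
  by rewrite -[_.*2 != _]negbK (inj_eq double_inj) (negPf l0).
have L0 i : (0 < i <= k)%N -> l (lab k i) = 0%N.
  move=> /lab_bound hi; apply/eqP; rewrite -leqn0 -l0 /csize.
  rewrite (@big_cat_nat _ _ _ (lab k i)) //=; [|lia|lia].
  by rewrite [X in (_ + X)%N]big_ltn; lia.
have X1 c : sigcoef k (fun i => l (lab k i)) c = 1.
  rewrite /sigcoef big_nat big1 // => i hi.
  by rewrite L0 // muln0 expr0 binq0 mulr1.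
rewrite /labcoef /coefx /coefPsi X1 big1 ?mulr0 ?addr0 // => i _.
by rewrite X1 subrr mulr0.
Qed.

Let mono_consU j s t : mono (j :: s) t = mono s t * U j.
Proof. by rewrite /mono big_cons mulrAC mulrC mulrA mulrAC. Qed.

Let mono_consQ j s t : mono s (j :: t) = mono s t * Q j.
Proof. by rewrite /mono big_cons mulrCA mulrC. Qed.

Let expo_consU j s t i : expo (j :: s) t i = expo s t i + uvec k j i.
Proof. by rewrite /expo big_cons; ring. Qed.

Let expo_consQ j s t i : expo s (j :: t) i = expo s t i - uvec k j i.
Proof. by rewrite /expo big_cons; ring. Qed.

Let eq_labcoef l c c' : (forall i, (0 < i <= k)%N -> c i = c' i) ->
  labcoef k l c = labcoef k l c'.
Proof. by move=> H; apply: eq_coefx. Qed.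

(** Lowering the content introduces the reciprocals of U_k and U_(k+1-j), so the induction has to
    treat all monomials in the U_j and their reciprocals at once. *)
Lemma phi_labcoef l s t : (csize k l <= N)%N -> all (leq^~ k) s ->
  all (leq^~ k) t -> phi l (mono s t) = labcoef k l (expo s t).
Proof.
elim: {l}(csize k l).+1 {-2}l (ltnSn (csize k l)) s t => // d IHd l ld s t lN.
(* Both sides turn the difference into a value at a smaller content, where they agree by
   induction. *)
have low j a s' t' : (j < k)%N -> all (leq^~ k) s' -> all (leq^~ k) t' ->
    a = mono s' t' ->
  phi l (a * (U j - U j.+1)) = labcoef k l (fun i => expo s' t' i + uvec k j i)
    - labcoef k l (fun i => expo s' t' i + uvec k j.+1 i).
  move=> jk hs ht ->; have hj : (0 < j.+1 <= k)%N by [].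
  have := @labcoef_rec k l (expo s' t') j.+1 hj; rewrite [j.+1.-1]/= => ->.
  have := @phi_step l j.+1 (mono s' t') lN hj; rewrite [j.+1.-1]/= => ->.
  case: eqP => // lj; rewrite -!mono_consQ.
  have lj0 : (0 < l j.+1)%N by rewrite lt0n; apply/eqP.
  have Ed := csize_decr hj lj0.
  have Ht : all (leq^~ k) [:: (k.+1 - j.+1)%N, k & t'].
    by apply/and3P; split; [rewrite /= subSS leq_subr | apply: leqnn | ].
  rewrite (IHd _ _ s' _ _ hs Ht); [|lia|lia].
  by apply: eq_labcoef => i _; rewrite !expo_consQ.
elim: s => [_|j s IHs /= /andP[jk hs] ht]; last first.
  elim: j jk => [|j IHj] jk.
    rewrite mono_consU U0 mulr1 IHs //; apply: eq_labcoef => i /andP[i0 _].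
    by rewrite expo_consU uvec0 // addr0.
  have := low j _ s t jk hs ht erefl.
  rewrite mulrBr phiB -!mono_consU IHj; last by lia.
  have -> : labcoef k l (expo (j :: s) t)
      = labcoef k l (fun i => expo s t i + uvec k j i).
    by apply: eq_labcoef => i _; rewrite expo_consU.
  move=> /addrI /oppr_inj ->.
  by apply: eq_labcoef => i _; rewrite expo_consU.
elim: t => [_|j t IHt /= /andP[jk ht]].
  rewrite /mono !big_nil mulr1 phi1 -labcoef0; apply: eq_labcoef => i _.
  by rewrite /expo !big_nil subr0.
elim: j jk => [|j IHj] jk.
  rewrite mono_consQ Q0 mulr1 IHt //; apply: eq_labcoef => i /andP[i0 _].
  by rewrite expo_consQ uvec0 // subr0.
(* Reciprocals are reached through Q_j Q_(j+1) (U_j - U_(j+1)) = Q_(j+1) - Q_j. *)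
have := low j _ [::] [:: j, j.+1 & t] jk isT.
rewrite /= jk (ltnW jk) => /(_ _ ht erefl).
rewrite mulrBr phiB.
have -> : mono [::] [:: j, j.+1 & t] * U j
   = mono [::] (j.+1 :: t) * U j * Q j by rewrite !mono_consQ; ring.
have -> : mono [::] [:: j, j.+1 & t] * U j.+1
   = mono [::] (j :: t) * U j.+1 * Q j.+1 by rewrite !mono_consQ; ring.
rewrite !phi_inv //; [|lia]; rewrite IHj; last by lia.
have -> : labcoef k l (expo [::] (j :: t))
  = labcoef k l (fun i => expo [::] [:: j, j.+1 & t] i + uvec k j.+1 i).
  by apply: eq_labcoef => i _; rewrite !expo_consQ; ring.
move=> /addIr ->; apply: eq_labcoef => i _.
by rewrite !expo_consQ; ring.
Qed.

Lemma phi_U l : (csize k l <= N)%N ->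
  phi l (U k) = labcoef k l (fun i => 1%:Z * dvec k i).
Proof.
move=> lN; have := @phi_labcoef l [:: k] [::] lN.
rewrite /= leqnn => /(_ isT isT); rewrite /mono big_nil mulr1 big_seq1 => ->.
by apply: eq_labcoef => i hi; rewrite /expo big_nil big_seq1 uveck //; ring.
Qed.

Lemma phi_U2 l : (csize k l <= N)%N ->
  phi l (U k * U k) = labcoef k l (fun i => 2%:Z * dvec k i).
Proof.
move=> lN; have := @phi_labcoef l [:: k; k] [::] lN.
rewrite /= leqnn => /(_ isT isT).
rewrite /mono big_nil mulr1 big_cons big_seq1 => ->.
apply: eq_labcoef => i hi.
by rewrite /expo big_nil big_cons big_seq1 uveck //; lia.
Qed.

Lemma phi_Q l j : (csize k l <= N)%N -> (j <= k)%N ->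
  phi l (Q j) = labcoef k l (fun i => - uvec k j i).
Proof.
move=> lN jk; have := @phi_labcoef l [::] [:: j] lN.
rewrite /= jk => /(_ isT isT); rewrite /mono big_nil mul1r big_seq1 => ->.
by apply: eq_labcoef => i hi; rewrite /expo big_nil big_seq1 sub0r.
Qed.

End Uniqueness.

(** * Extraction of the coefficient of a content *)

Section Coefficients.
Variable k : nat.
Local Notation poly_ring := {mpoly rat[k.+1]}.
Implicit Types (l : nat -> nat) (p : poly_ring) (P Q : {poly poly_ring}).

(* The label 0 is not allowed in a tree: its weight vanishes. *)
Definition label_wt (c : 'I_k.+1) : poly_ring := if c == ord0 then 0 else 'X_c.

(** Label 0 has a variable as well; its exponent is 0 whatever [l 0] is. *)
Definition content_mon l : 'X_{1..k.+1} :=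
  [multinom (if i == ord0 then 0%N else l i) | i < k.+1].

(** The power of the vertex variable is tied to the total content, so a bound on the content keeps
    the extraction within the degrees where the series are exact. *)
Definition content_coef l P : rat := (P`_(csize k l))@_(content_mon l).

Lemma mcoeffMU_eq0 p (c : 'I_k.+1) (m : 'X_{1..k.+1}) :
  m c = 0%N -> (p * 'X_c)@_m = 0.
Proof.
move=> mc; rewrite [p]mpolyE mulr_suml raddf_sum big1 //= => m' _.
rewrite -scalerAl -mpolyXD mcoeffZ mcoeffX; case: eqP => [E|]; last by rewrite mulr0.
by move: mc; rewrite -E mnmDE mnm1E eqxx addn1.
Qed.

Lemma content_mon_decr l (j : 'I_k.+1) : (0 < j)%N -> (0 < l j)%N ->
  content_mon l = (U_(j) + content_mon (decr j l))%MM.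
Proof.
move=> j0 lj; apply/mnmP => i; rewrite mnmDE !mnmE /decr.
have jn0 : (j == ord0) = false by rewrite -val_eqE /=; lia.
have [->|ij] := eqVneq i j; first by rewrite jn0 eqxx; lia.
rewrite -val_eqE eq_sym /= in ij.
by case: eqP => _; rewrite ?(negPf ij) // eq_sym (negPf ij); lia.
Qed.

Lemma content_coefB l P Q :
  content_coef l (P - Q) = content_coef l P - content_coef l Q.
Proof. by rewrite /content_coef coefB mcoeffB. Qed.

Lemma content_coef1 l : content_coef l 1 = (csize k l == 0)%N%:R.
Proof.
rewrite /content_coef coef1; case: eqP => [l0|_]; last by rewrite mcoeff0.
rewrite mcoeff1; case: eqP => // -[]; apply/mnmP => i; rewrite mnmE mnm0E.
case: eqP => // /eqP i0.
suff : (l i <= csize k l)%N by rewrite l0; lia.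
rewrite -val_eqE /= in i0; have ik := ltn_ord i.
rewrite /csize (@big_cat_nat _ _ _ i) //=; [|lia|lia].
by rewrite [X in (_ + X)%N]big_ltn; lia.
Qed.

Lemma content_coef_step l P (j : 'I_k.+1) : (0 < j)%N ->
  content_coef l (P * ('X * (label_wt j)%:P))
  = if l j == 0%N then 0 else content_coef (decr j l) P.
Proof.
move=> j0; have jk : (0 < j <= k)%N by rewrite j0 -ltnS ltn_ord.
have jn0 : (j == ord0) = false by rewrite -val_eqE /=; lia.
rewrite /content_coef [label_wt j]/label_wt jn0 mulrCA coefXM mulrC coefCM.
have [lj|lj] := eqVneq (l j) 0%N.
  case: ifP => _; first by rewrite mcoeff0.
  rewrite mulrC mcoeffMU_eq0 // mnmE; case: ifP => //.
rewrite -lt0n in lj; rewrite (csize_decr jk lj) /= mulrC.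
by rewrite (content_mon_decr j0 lj) mcoeffMX.
Qed.

Lemma eq_content_coef n l P Q : (csize k l <= n)%N -> eqtr n P Q ->
  content_coef l P = content_coef l Q.
Proof. by move=> ln H; rewrite /content_coef H. Qed.

(** A label 0 makes the product vanish, which enforces [is_labelling]; otherwise the product is one
    monomial recording how often each label occurs. *)
Lemma content_coef_weight l (n : nat) (f : 'I_n -> 'I_k.+1) :
  (\prod_x label_wt (f x))@_(content_mon l)
  = ([forall x, 0 < f x] && [forall c : 'I_k.+1, (0 < c) ==>
      (#|[set x | f x == c]| == l c)])%N%:R.
Proof.
have [/forallP pos|] := boolP [forall x, (0 < f x)%N]; last first.
  rewrite negb_forall => /existsP[x]; rewrite -leqNgt leqn0 => fx.
  by rewrite (bigD1 x) //= /label_wt -val_eqE /= fx mul0r mcoeff0.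
have -> : \prod_x label_wt (f x) = 'X_[\sum_x U_(f x)].
  rewrite (big_morph _ (@mpolyXD _ _) (mpolyX0 _ _)).
  apply: eq_bigr => x _; rewrite /label_wt.
  by have := pos x; rewrite -val_eqE /=; case: eqP => // ->.
have E c : (\sum_x U_(f x))%MM c = #|[set x | f x == c]|.
  rewrite mnm_sumE cardsE -sum1_card [RHS]big_mkcond /=.
  by apply: eq_bigr => x _; rewrite mnm1E -[x \in _]/(f x == c); case: (f x == c).
rewrite mcoeffX /=; congr (nat_of_bool _)%:R.
apply/eqP/forallP => [H c|H].
  apply/implyP => c0; rewrite -E H mnmE; case: ifP => // /eqP c0'.
  by rewrite c0' in c0.
apply/mnmP => c; rewrite E mnmE; case: eqP => [->|/eqP c0].
  apply/eqP; rewrite cards_eq0; apply/eqP/setP => x; rewrite !inE.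
  by apply/negbTE; rewrite -val_eqE /= -lt0n.
by apply/eqP; have /implyP := H c; apply; rewrite lt0n -val_eqE in c0 *.
Qed.

End Coefficients.

(** * The numbers of trees as coefficients *)

Section Count.
Variables (n k : nat) (l : nat -> nat).
Hypothesis k_gt0 : (0 < k)%N.
Hypothesis size_l : csize k l = n.+1.

Local Notation wt := (@label_wt k).
Local Notation U := (@Useries n.+1 k _ wt).
Local Notation Q := (@Qseries n.+1 k _ wt).
Local Notation phi := (@content_coef k).

Lemma label_wt0 : wt ord0 = 0. Proof. by rewrite /label_wt eqxx. Qed.

Lemma in_trees_full (y : 'I_n.+1 * {ffun 'I_n.+1 -> 'I_n.+1 * 'I_k.+1}) c :
  [&& y \in trees n.+1 k 0 n, root_lbl y == c & y.1 == 0 :> nat]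
  = [&& y.1 == ord0, rooted_tree (vseg n.+1 0 n) ord0 y.2 & lbl y.2 ord0 == c].
Proof.
case: y => r g; rewrite inE /root_lbl /= -[_ == ord0]val_eqE /=.
have [r0|_] := eqVneq (r : nat) 0%N; last by rewrite !andbF.
have -> : r = ord0 by apply: val_inj.
by rewrite andbT.
Qed.

Lemma card_root (c : 'I_k.+1) :
  #|k_noncrossing_trees_root n.+1 k l c|%:R = phi l (leftS n.+1 wt c) :> rat.
Proof.
rewrite /content_coef size_l coef_leftS // add0n.
transitivity (#|[set t : {set {set 'I_n.+1}} * {ffun 'I_n.+1 -> 'I_k.+1} |
   k_noncrossing_tree t.1 t.2 && (has_content l t.2 && root_label c t.2)]|%:R : rat).
  by congr (_%:R); apply: eq_card => t; rewrite !inE andbA.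
rewrite (@card_k_noncrossing n k (fun f => has_content l f && root_label c f)).
rewrite /left_sum raddf_sum /= (eq_bigl _ _ (fun y => in_trees_full y c)).
rewrite -(pair_big (pred1 ord0) (fun g => rooted_tree (vseg n.+1 0 n) ord0 g
   && (lbl g ord0 == c)) (fun _ g => (weight wt 0 n g)@_(content_mon k l))) /=.
rewrite big_pred1_eq -sum1_card natr_sum big_mkcond /= [RHS]big_mkcond /=.
apply: eq_bigr => g _; rewrite inE.
have -> : root_label c (labelling g) = (lbl g ord0 == c).
  apply/forallP/idP => [/(_ ord0)/implyP/(_ (eqxx _))|/eqP gc r].
    by rewrite ffunE.
  apply/implyP => /eqP r0; have -> : r = ord0 by apply: val_inj.
  by rewrite ffunE gc.
rewrite [X in _ = X]if_and; case: (rooted_tree _ _ _) => //=.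
case: (lbl g ord0 == c); last by rewrite !andbF.
rewrite andbT /weight (eq_bigl xpredT) => [|x]; last exact: in_full.
have -> : \prod_x wt (lbl g x) = \prod_x wt (labelling g x).
  by apply: eq_bigr => x _; rewrite ffunE.
by rewrite content_coef_weight; case: ifP.
Qed.

Lemma card_all : #|k_noncrossing_trees n.+1 k l|%:R
  = \sum_(c : 'I_k.+1) phi l (leftS n.+1 wt c) :> rat.
Proof.
under eq_bigr do rewrite -card_root.
rewrite -natr_sum; congr (_%:R); rewrite -sum1_card.
rewrite (partition_big (fun t : {set {set 'I_n.+1}} *
  {ffun 'I_n.+1 -> 'I_k.+1} => t.2 ord0) xpredT) //=.
apply: eq_bigr => c _; rewrite -sum1_card; apply: eq_bigl => t.
rewrite [RHS]inE; congr (_ && _); apply/idP/forallP => [/eqP tc r|].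
  by apply/implyP => /eqP r0; have -> : r = ord0 by [apply: val_inj]; rewrite tc.
by move=> /(_ ord0)/implyP/(_ (eqxx _)).
Qed.

Lemma phi_Useries_inv l' j (P : {poly {mpoly rat[k.+1]}}) :
  (csize k l' <= n.+1)%N -> phi l' (P * U j * Q j) = phi l' P.
Proof.
move=> ln; apply: (eq_content_coef ln); rewrite -mulrA -[X in eqtr _ _ X]mulr1.
by apply: eqtrM => //; apply: Useries_inv.
Qed.

Lemma phi_Useries_step l' j (P : {poly {mpoly rat[k.+1]}}) :
    (csize k l' <= n.+1)%N -> (0 < j <= k)%N ->
  phi l' (P * (U j.-1 - U j))
  = if l' j == 0%N then 0 else phi (decr j l') (P * Q k * Q (k.+1 - j)%N).
Proof.
move=> ln /andP[j0 jk]; have jk1 : (j < k.+1)%N by [].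
have := content_coef_step l' (P * Q k * Q (k.+1 - j)%N) (j := Ordinal jk1) j0.
move=> /= <-; apply: (eq_content_coef ln).
rewrite (Useries_step _ _ (c := Ordinal jk1)) //.
have -> : P * Q k * Q (k.+1 - j)%N * ('X * (wt (Ordinal jk1))%:P)
  = P * ('X * (wt (Ordinal jk1))%:P * Q k * Q (k.+1 - j)%N) by ring.
by apply: eqtrM => //; apply: innerS_Q.
Qed.

Let phiU l' : (csize k l' <= n.+1)%N ->
  phi l' (U k) = labcoef k l' (fun i => 1%:Z * dvec k i).
Proof.
apply: (@phi_U k n.+1 _ (@content_coef k) U Q) => //.
- exact: content_coefB.
- exact: content_coef1.
- exact: (Useries0 _ label_wt0).
- exact: (Qseries0 _ label_wt0).
- by move=> *; apply: phi_Useries_inv.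
- exact: phi_Useries_step.
Qed.

Let phiU2 l' : (csize k l' <= n.+1)%N ->
  phi l' (U k * U k) = labcoef k l' (fun i => 2%:Z * dvec k i).
Proof.
apply: (@phi_U2 k n.+1 _ (@content_coef k) U Q) => //.
- exact: content_coefB.
- exact: content_coef1.
- exact: (Useries0 _ label_wt0).
- exact: (Qseries0 _ label_wt0).
- by move=> *; apply: phi_Useries_inv.
- exact: phi_Useries_step.
Qed.

Let phiQ l' j : (csize k l' <= n.+1)%N -> (j <= k)%N ->
  phi l' (Q j) = labcoef k l' (fun i => - uvec k j i).
Proof.
apply: (@phi_Q k n.+1 _ (@content_coef k) U Q) => //.
- exact: content_coefB.
- exact: content_coef1.
- exact: (Useries0 _ label_wt0).
- exact: (Qseries0 _ label_wt0).
- by move=> *; apply: phi_Useries_inv.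
- exact: phi_Useries_step.
Qed.

Lemma card_root_labcoef (h : nat) : (0 < h <= k)%N ->
  #|k_noncrossing_trees_root n.+1 k l h|%:R
  = if l h == 0%N then 0
    else labcoef k (decr h l) (fun i => - uvec k (k.+1 - h) i) :> rat.
Proof.
move=> hk; have /andP[h0 h1] := hk; have hk1 : (h < k.+1)%N by [].
rewrite (card_root (Ordinal hk1)).
have ln : (csize k l <= n.+1)%N by rewrite size_l.
rewrite (eq_content_coef ln (leftS_Q wt (Ordinal hk1))) mulrC.
rewrite content_coef_step //=; case: eqP => // /eqP lh.
rewrite -lt0n in lh; have E := csize_decr hk lh.
by rewrite phiQ //; lia.
Qed.

Lemma card_all_labcoef :
  #|k_noncrossing_trees n.+1 k l|%:R
  = labcoef k l (fun i => 1%:Z * dvec k i)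
    - labcoef k l (fun i => 2%:Z * dvec k i) :> rat.
Proof.
have ln : (csize k l <= n.+1)%N by rewrite size_l.
rewrite card_all -phiU // -phiU2 // -content_coefB.
(* N_c is replaced by B_c U_k, and the B_c add up to 1 - U_k. *)
rewrite (eq_bigr (fun c => phi l (innerS n.+1 wt c * U k))); last first.
  by move=> c _; apply: (eq_content_coef ln); apply: eqtr_sym; apply: innerS_eq.
have sumE (r : seq 'I_k.+1) (F : 'I_k.+1 -> {poly {mpoly rat[k.+1]}}) :
  \sum_(c <- r) phi l (F c) = phi l (\sum_(c <- r) F c).
  by rewrite /content_coef coef_sum raddf_sum.
rewrite sumE -mulr_suml; congr (phi l _).
rewrite -[X in _ = X - _]mul1r -mulrBl; congr (_ * _).
rewrite /Useries /partialS subKr; apply: eq_bigl => c.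
by rewrite -ltnS ltn_ord.
Qed.

End Count.

Theorem theorem1p2 (k n h : nat) (l : nat -> nat)
    (hk : (1 <= k)%N) (hn : (1 < n)%N) (hh : (1 <= h <= k)%N)
    (hl : (\sum_(1 <= j < k.+1) l j)%N = n) :
  [/\ (h <= uphalf k)%N ->
      (#|k_noncrossing_trees_root n k l h|%:R : rat) =
        2 * (l h)%:R / ((2 * n%:R - 1) * (4 * n%:R - 3))
          * (\prod_(1 <= r < (uphalf k).+1) binA n k l 2 r)
          * (\prod_(1 <= r < h) binB n k l 2 r)
          * (\prod_(h <= r < (k./2).+1) binB n k l 1 r)
        - (l h)%:R / ((4 * n%:R - 3) * (3 * n%:R - 2 - (sumA k l h)%:R))
          * (\prod_(1 <= r < (k./2).+1) binB n k l 1 r)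
          * (\prod_(1 <= r < h) binA n k l 3 r)
          * (\prod_(h <= r < (uphalf k).+1) binA n k l 2 r),
      (uphalf k < h)%N ->
      (#|k_noncrossing_trees_root n k l h|%:R : rat) =
        (l h)%:R / ((n%:R - 1) * (4 * n%:R - 3))
          * (\prod_(1 <= r < (k./2).+1) binB n k l 2 r)
          * (\prod_(1 <= r < k.+2 - h) binA n k l 2 r)
          * (\prod_(k.+2 - h <= r < (uphalf k).+1) binA n k l 3 r)
        - (l h)%:R / ((4 * n%:R - 3)
                      * (n%:R - 1 + (sumB k l (k.+1 - h)%N)%:R))
          * (\prod_(1 <= r < (uphalf k).+1) binA n k l 3 r)
          * (\prod_(1 <= r < k.+2 - h) binB n k l 1 r)
          * (\prod_(k.+2 - h <= r < (k./2).+1) binB n k l 2 r)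
    & (#|k_noncrossing_trees n k l|%:R : rat) =
        1 / (n%:R - 1)
          * (\prod_(1 <= r < (uphalf k).+1) binA n k l 3 r)
          * (\prod_(1 <= r < (k./2).+1) binB n k l 2 r)
        - 1 / (2 * n%:R - 1)
          * (\prod_(1 <= r < (uphalf k).+1) binA n k l 2 r)
          * (\prod_(1 <= r < (k./2).+1) binB n k l 1 r)].
Proof.
have size_l : csize k l = n.-1.+1 by rewrite prednK // ltnW.
have root_eq := card_root_labcoef hk size_l hh.
have all_eq := card_all_labcoef hk size_l.
rewrite prednK ?(ltnW hn) // in root_eq all_eq.
split=> [hu|hu|].
(* If no vertex is labelled h, the count is 0 and both terms vanish through their factor l_h. *)
- rewrite root_eq; have [->|lh] := eqVneq (l h) 0%N.
    by rewrite !(mulr0, mul0r) subrr.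
  by rewrite labcoef_root_low // /csize ?hl // lt0n.
- rewrite root_eq; have [->|lh] := eqVneq (l h) 0%N.
    by rewrite !(mulr0, mul0r) subrr.
  by rewrite labcoef_root_high // /csize ?hl // lt0n.
(* The powers a = 1 and a = 2 of U_k; the bound a < 2n holds for a = 2 because n > 1. *)
rewrite all_eq !labcoef_u // /csize hl; try lia.
set A2 := \prod_(_ <= r < _) binA _ _ _ 2 r.
set A3 := \prod_(_ <= r < _) binA _ _ _ 3 r.
set B1 := \prod_(_ <= r < _) binB _ _ _ 1 r.
set B2 := \prod_(_ <= r < _) binB _ _ _ 2 r.
have n1 : n%:R - 1 != 0 :> rat by rewrite subr_eq0 (eqr_nat _ n 1); lia.
have n2 : 2 * n%:R - 1 != 0 :> rat.
  by rewrite -natrM subr_eq0 (eqr_nat _ _ 1); lia.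
have -> : 1%:R - 2 * n%:R = - (2 * n%:R - 1) :> rat by ring.
have -> : 2%:R - 2 * n%:R = - (2 * (n%:R - 1)) :> rat by ring.
by field; rewrite n1 n2.
Qed.
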